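(* Let $1\le K<N$ be integers, $\varkappa\in\mathbb{GT}_K$ and $\nu\in\mathbb{GT}_N$. Then \[ \frac{\mathrm{Dim}_{K,N}(\varkappa,\nu)}{\mathrm{Dim}_N\nu}=\det\big[A_i(\varkappa_j-j)\big]_{i,j=1}^{K}, \] where for $i=1,\dots,K$ and $x\in\mathbb{Z}$, \[ A_i(x)=A_i(x\mid K,N,\nu):=\frac{N-K}{2\pi i}\oint_{\mathfrak{C}(x)}\frac{(z-x+1)_{N-K-1}}{(z+i)_{N-K+1}}\,H^*(z;\nu)\,dz,\qquad H^*(z;\nu):=\prod_{r=1}^{N}\frac{z+r}{z+r-\nu_r}, \] and $\mathfrak{C}(x)$ is a positively oriented simple contour encircling the points $x,x+1,\dots,\nu_1-1$ and not encircling the points $x-1,x-2,\dots,\nu_N-N$.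
   Context: A signature of length $N$ is an $N$-tuple of integers $\nu=(\nu_1\ge\nu_2\ge\dots\ge\nu_N)$; $\mathbb{GT}_N$ is the set of such signatures, and $\mathbb{GT}_0=\{\varnothing\}$. For $\mu\in\mathbb{GT}_{N-1}$, $\nu\in\mathbb{GT}_N$ write $\mu\prec\nu$ if $\nu_1\ge\mu_1\ge\nu_2\ge\mu_2\ge\dots\ge\mu_{N-1}\ge\nu_N$; by convention $\varnothing\prec\lambda$ for every $\lambda\in\mathbb{GT}_1$. $\mathrm{Dim}_N\nu$ is the number of sequences $\varnothing\prec\nu^{(1)}\prec\nu^{(2)}\prec\dots\prec\nu^{(N)}=\nu$ with $\nu^{(m)}\in\mathbb{GT}_m$. For $K<N$, $\varkappa\in\mathbb{GT}_K$, $\nu\in\mathbb{GT}_N$, $\mathrm{Dim}_{K,N}(\varkappa,\nu)$ is the number of sequences $\varkappa=\nu^{(K)}\prec\nu^{(K+1)}\prec\dots\prec\nu^{(N)}=\nu$ with $\nu^{(m)}\in\mathbb{GT}_m$. $(y)_m=y(y+1)\cdots(y+m-1)$, $(y)_0=1$, is the Pochhammer symbol. *)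

(* Defs.v *)
From HB Require Import structures.
From mathcomp Require Import all_boot all_order all_algebra.
From mathcomp Require Import finmap complex.
From mathcomp Require Import all_classical all_reals all_analysis.

Set Implicit Arguments.
Unset Strict Implicit.
Unset Printing Implicit Defensive.

Import Order.TTheory GRing.Theory Num.Theory.
Import numFieldNormedType.Exports.

Local Open Scope classical_set_scope.
Local Open Scope ring_scope.
Local Open Scope complex_scope.

Definition GT (N : nat) : {pred N.-tuple int} :=
  [pred nu : N.-tuple int | sorted >=%O nu].
Arguments GT N : clear implicits.

(* [prec mu nu] is mu ≺ nu; the lengths are carried by the sequences, so that
   a chain in the Gelfand-Tsetlin graph is a [path] for this relation. In
   particular [prec [::] nu] holds for every nu of length 1. *)
Definition prec : rel (seq int) := fun mu nu =>
  [&& size nu == (size mu).+1, sorted >=%O mu, sorted >=%O nu &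
      all (fun r => nu`_r.+1 <= mu`_r <= nu`_r) (iota 0 (size mu))].

(* p lists the terms of the chain that come after kappa, nu included. *)
Definition chains (kappa nu : seq int) : set (seq (seq int)) :=
  [set p | path prec kappa p && (last kappa p == nu)].

(* [chains kappa nu] is finite (see [finite_chains]), so the cardinal of
   [fset_set] is its number of elements. *)
Definition DimKN (K N : nat) (kappa : K.-tuple int) (nu : N.-tuple int) : nat :=
  #|` fset_set (chains kappa nu)|.

Definition Dim (N : nat) (nu : N.-tuple int) : nat :=
  #|` fset_set (chains [::] nu)|.

Lemma finite_prec (nu : seq int) : finite_set [set mu | prec mu nu].
Proof.
pose B := \max_(x <- nu) `|x|%N.
have leB x : x \in nu -> (`|x| <= B)%N.
  by move=> xnu; rewrite /B (big_rem x) //= leq_maxl.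
pose e (k : 'I_(2 * B).+1) : int := k%:Z - B%:Z.
apply: (@sub_finite_set _ _
  ((fun t : (size nu).-1.-tuple 'I_(2 * B).+1 => map e t) @` setT)); last first.
  exact: finite_image.
move=> mu /= /and4P[/eqP snu _ _ /allP h].
have smu : size mu = (size nu).-1 by rewrite snu.
pose k (x : int) : 'I_(2 * B).+1 := inord `|x + B%:Z|.
have sz : size (map k mu) == (size nu).-1 by rewrite size_map smu.
exists (Tuple sz) => //=.
rewrite -map_comp -[RHS]map_id; apply/eq_in_map => x /(nthP 0)[r rmu <-] /=.
have /h/andP[h1 h2] : r \in iota 0 (size mu) by rewrite mem_iota add0n.
have /leB b1 : nu`_r.+1 \in nu by rewrite mem_nth // snu ltnS.
have /leB b2 : nu`_r \in nu by rewrite mem_nth // snu ltnS ltnW.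
move: (nth 0 mu r) h1 h2 b1 b2 => y h1 h2 b1 b2.
have {}b1 : - B%:Z <= nu`_r.+1.
  by rewrite lerNl (le_trans (ler_norm _))// normrN -abszE lez_nat.
have {}b2 : nu`_r <= B%:Z by rewrite (le_trans (ler_norm _))// -abszE lez_nat.
have y0 : 0 <= y + B%:Z by rewrite -lerBlDr sub0r (le_trans b1).
rewrite /e /k inordK.
  by rewrite gez0_abs // addrK.
by rewrite ltnS -lez_nat gez0_abs // mul2n -addnn PoszD lerD2r (le_trans h2).
Qed.

Lemma finite_chains (kappa nu : seq int) : finite_set (chains kappa nu).
Proof.
have key n : forall nu, finite_set [set p | chains kappa nu p /\ size p = n].
  elim: n => [|n IHn] {}nu.
    by apply: (@sub_finite_set _ _ [set [::]]) => // p /= [_ /size0nil ->].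
  apply: (@sub_finite_set _ _ (\bigcup_(mu in [set mu | prec mu nu])
    ((fun p => rcons p nu) @` [set p | chains kappa mu p /\ size p = n]))).
    move=> p; case/lastP: p => [[_]//|p x]; rewrite /chains /= => -[].
    rewrite rcons_path last_rcons => /andP[/andP[kp px] /eqP xnu].
    rewrite size_rcons => -[sp].
    exists (last kappa p) => /=; first by rewrite -xnu.
    by exists p; rewrite ?xnu //; split=> //; rewrite /chains /= kp eqxx.
  apply: bigcup_finite; first exact: finite_prec.
  by move=> mu _; exact: finite_image.
apply: sub_finite_set (key (size nu - size kappa)%N nu) => p kp.
split=> //; move: kp => /= /andP[kp /eqP <-].
elim: p kappa kp {key} => [|x p IHp] kappa /=; first by rewrite subnn.
move=> /andP[/and4P[/eqP sx _ _ _] xp].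
suff: size (last x p) = (size p + size x)%N by move=> ->; rewrite sx -addSnnS addnK.
elim: p x xp {IHp sx} => [|y p IHp] x //= /andP[/and4P[/eqP sy _ _ _] yp].
by rewrite (IHp y yp) sy addnS.
Qed.

Section Contours.
Context {R : realType}.
Implicit Types (f : R -> R) (g : R -> R[i]) (F : R[i] -> R[i]) (w z : R[i]).

Local Notation Re := (@complex.Re R).
Local Notation Im := (@complex.Im R).

(* f is C^1 on the closed interval [s, t], with one-sided derivatives at the
   endpoints: f' on ]s, t[ extends continuously to [s, t]. *)
Definition C1_on (s t : R) f : Prop :=
  [/\ {within `[s, t], continuous f},
      {in `]s, t[, forall u, derivable f u 1} &
      exists2 h : R -> R, {within `[s, t], continuous h} &
        {in `]s, t[, forall u, derive1 f u = h u}].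

Definition piecewise_C1 g : Prop :=
  exists2 ts : seq R, path <%R 0 ts && (last 0 ts == 1) &
    forall k, (k < size ts)%N ->
      C1_on (0 :: ts)`_k ts`_k (Re \o g) /\ C1_on (0 :: ts)`_k ts`_k (Im \o g).

(* Contours are parametrized by [0, 1]; values of g outside are irrelevant. *)
Definition simple_contour g : Prop :=
  [/\ piecewise_C1 g, g 0 = g 1 & {in `[0, 1[ &, injective g}].

Definition contour_trace g : set R[i] := g @` `[0, 1].

Definition velocity g (t : R) : R[i] := derive1 (Re \o g) t +i* derive1 (Im \o g) t.

Definition integral01 (h : R -> R[i]) : R[i] :=
  (\int[lebesgue_measure]_(t in `[0, 1]) Re (h t))%R +i*
  (\int[lebesgue_measure]_(t in `[0, 1]) Im (h t))%R.

Definition contour_integral g F : R[i] :=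
  integral01 (fun t => F (g t) * velocity g t).

Definition two_pi_i : R[i] := 0 +i* (2 * pi).

Definition winding_number g w : R[i] :=
  two_pi_i^-1 * contour_integral g (fun z => (z - w)^-1).

(* The cast gives R[i] the topology of its norm. *)
Definition component_of g w : set (R[i] : numFieldType) :=
  connected_component (~` contour_trace g : set (R[i] : numFieldType)) w.

Definition encircles g w : Prop :=
  ~ contour_trace g w /\ bounded_set (component_of g w).

(* Not encircled, and not on the contour either. *)
Definition lies_outside g w : Prop :=
  ~ contour_trace g w /\ ~ bounded_set (component_of g w).

Definition positively_oriented g : Prop :=
  forall w, encircles g w -> winding_number g w = 1.

(* The poles nu_r - r of [Hstar] all lie among the points p listed here. *)
Definition is_contour_for (N : nat) (nu : N.-tuple int) (x : int) g : Prop :=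
  [/\ simple_contour g, positively_oriented g,
      forall p : int, x <= p <= nu`_0 - 1 -> encircles g p%:~R &
      forall p : int, nu`_N.-1 - N%:Z <= p <= x - 1 -> lies_outside g p%:~R].

Definition pochhammer (y : R[i]) (m : nat) : R[i] := \prod_(k < m) (y + k%:R).

(* nu_r of the usual 1-based indexing is [tnth nu r] with r shifted by one. *)
Definition Hstar (N : nat) (nu : N.-tuple int) z : R[i] :=
  \prod_(r < N) ((z + r.+1%:R) / (z + r.+1%:R - (tnth nu r)%:~R)).

(* i ranges over 1, ..., K. *)
Definition A_fun (K N : nat) (nu : N.-tuple int) (C : int -> R -> R[i])
    (i : nat) (x : int) : R[i] :=
  (N - K)%:R / two_pi_i *
  contour_integral (C x) (fun z =>
    pochhammer (z - x%:~R + 1) (N - K - 1) / pochhammer (z + i%:R) (N - K + 1)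
    * Hstar nu z).

End Contours.

(* Main.v *)
Require Import Defs.
From mathcomp Require Import all_boot all_order all_algebra.
From mathcomp Require Import finmap complex.
From mathcomp Require Import all_classical all_reals all_analysis.
From mathcomp Require Import perm measurable_realfun zify ring lra.

Set Implicit Arguments.
Unset Strict Implicit.
Unset Printing Implicit Defensive.

Import Order.TTheory GRing.Theory Num.Theory.

(** Write D = N - K, p_r = nu_r - r, x_j = kappa_j - j and V_r = prod_(s <> r) (p_r - p_s).

    Summing a determinant over all mu interlacing with nu amounts to summing each row over
    an interval, so iterating from N = K shows that Dim_(K,N)(kappa, nu) is the determinant of
    the matrix whose r-th row is f_1(p_r), ..., f_K(p_r), b_(D-1)(p_r), ..., b_0(p_r), where
    f_j is the D-fold sum of the indicator function of x_j and b_m(z) = (z + 1)_m / m!; the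
    case K = 0 gives Dim_N nu. Multiplying both matrices on the left by
    [(p_r + 1)_k / V_r]_(k,r) makes them block triangular, because the divided difference
    L(q) = sum_r q(p_r) / V_r is the coefficient of z^(N-1) in q when deg q < N. The quotient
    is therefore det [L(f_j (z + 1)_k)]_(k < K) * prod_(c < K) (N - 1 - c)!, and a triangular
    change of basis turns the polynomials (z + 1)_k into (z + 1)_N / (z + i)_(D+1), giving
    det [D! L(f_j (z + 1)_N / (z + i)_(D+1))].

    On the other side, partial fractions express A_i(x) through the integrals
    I(w) = oint dz / (z - w) at w = p_r. Orientation gives I = 2 pi i at encircled poles. For
    the other poles, oint dz / (z - w)^2 = 0 yields |I(w) - I(w')| <= C |w - w'|^2 locally, so
    I is locally constant off the contour, and on the unbounded component it must vanish. *)

Local Open Scope ring_scope.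

(** * Counting chains by determinants *)

Definition int_range (b a : int) : seq int :=
  [seq b + k%:Z | k <- iota 0 `|a - b|%N.+1].
Arguments int_range : simpl never.

Lemma mem_int_range b a x : b <= a -> (x \in int_range b a) = (b <= x <= a).
Proof.
move=> ba; apply/mapP/idP => [[k]|/andP[bx xa]].
  by rewrite mem_iota => /andP[_ kl] ->; lia.
by exists `|x - b|%N; rewrite ?mem_iota; lia.
Qed.

Lemma int_range_uniq b a : uniq (int_range b a).
Proof. by rewrite map_inj_uniq ?iota_uniq// => i j /addrI[]. Qed.

Lemma telescope_int_range (V : zmodType) (g : int -> V) b a : b <= a ->
  \sum_(x <- int_range b a) (g x - g (x - 1)) = g a - g (b - 1).
Proof.
move=> ba; rewrite /int_range big_map.
have E : a = b + `|a - b|%N.+1%:Z - 1 by lia.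
rewrite [X in _ = g X - _]E {E}; elim: `|a - b|%N.+1 => [|n IHn].
  by rewrite big_nil addr0 subrr.
rewrite -[n.+1]addn1 iotaD big_cat big_seq1 IHn /= add0n addrC.
rewrite [in RHS]addn1 (_ : b + n.+1%:Z - 1 = b + n%:Z); last by lia.
by rewrite addrA addrNK.
Qed.

(** The head [a] is a separate argument so that the recursion is structural in [t]. Each coordinate
    is confined between two consecutive entries of [a :: t], so the interlacing rows form a box of
    integer ranges. *)
Fixpoint interlacings (a : int) (t : seq int) : seq (seq int) :=
  if t is b :: t' then
    [seq x :: m | x <- int_range b a, m <- interlacings b t']
  else [:: [::]].

Lemma interlacings_cons a b t : interlacings a (b :: t) =
  [seq x :: m | x <- int_range b a, m <- interlacings b t].
Proof. by []. Qed.

Lemma mem_interlacings (a : int) (t mu : seq int) : sorted >=%O (a :: t) ->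
  (mu \in interlacings a t) = prec mu (a :: t).
Proof.
elim: t a mu => [|b t IHt] a mu.
  by rewrite inE /prec; case: mu => [|x []].
rewrite interlacings_cons [sorted _ _]/=; move=> /andP[ba pt].
apply/allpairsPdep/idP => /=.
  move=> [x [m [xr mi ->]]].
  have := mi; rewrite IHt// /prec => /and4P[/= sm ms bs al].
  rewrite mem_int_range// in xr.
  rewrite /prec /= eqSS sm ba pt xr /=; apply/andP; split.
    case: m sm ms al {mi} => [//|y m] /= _ -> /andP[/andP[_ yb] _].
    (* [x :: m] is decreasing because [b] separates [x] from the head [y] of [m]. *)
    by rewrite andbT; apply: le_trans yb _; case/andP: xr.
  by rewrite -[1%N]addn0 iotaDl all_map; apply: sub_all al.
case: mu => [|x m]; rewrite /prec /= ?andbF// => /and4P[sm ms _ /andP[xr al]].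
exists x, m; split=> //; first by rewrite mem_int_range.
rewrite IHt// /prec /= -eqSS sm pt (path_sorted ms) /=.
move: al; rewrite -[1%N]addn0 iotaDl all_map; exact: sub_all.
Qed.

Lemma interlacings_uniq a t : uniq (interlacings a t).
Proof.
elim: t a => // b t IHt a.
rewrite interlacings_cons; apply: allpairs_uniq_dep; rewrite ?int_range_uniq//.
by move=> [x m] [y n] _ _ /= [-> ->].
Qed.

(** Chains are built from their last level downwards, so that their number is a sum over
    [interlacings] of the numbers one level below. *)
Fixpoint enum_chains (n : nat) (kappa nu : seq int) : seq (seq (seq int)) :=
  if n is n'.+1 then
    [seq rcons p nu | mu <- interlacings (head 0 nu) (behead nu),
                      p <- enum_chains n' kappa mu]
  else if kappa == nu then [:: [::]] else [::].

Lemma size_last_chain kappa p : path prec kappa p ->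
  size (last kappa p) = (size p + size kappa)%N.
Proof.
elim: p kappa => //= x p IHp kappa /andP[/and4P[/eqP sx _ _ _] xp].
by rewrite (IHp x xp) sx addnS.
Qed.

Lemma mem_enum_chains n (kappa nu : seq int) p : sorted >=%O nu ->
  size nu = (n + size kappa)%N ->
  (p \in enum_chains n kappa nu) = (path prec kappa p && (last kappa p == nu)).
Proof.
elim: n nu p => [|n IHn] nu p snu sznu /=.
  case: p => [|x p] /=; first by case: eqP.
  (* Each step lengthens the signature by one, so a nonempty chain cannot end at the length of
     [kappa]. *)
  transitivity false; first by case: eqP.
  apply/esym/negP => /andP[xp /eqP lp].
  have /= := @size_last_chain kappa (x :: p) xp; rewrite lp sznu; lia.
case: nu snu sznu => [|a t] // snu sznu /=.
have {}sznu : size t = (n + size kappa)%N by case: sznu.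
apply/allpairsPdep/idP => /=.
  move=> [mu [q [mui]]]; have := mui; rewrite mem_interlacings// => pm qi ->.
  have /and4P[/eqP /= [szm] smu _ _] := pm.
  move: qi; rewrite IHn//; last by rewrite -szm.
  move=> /andP[pq /eqP lq].
  by rewrite rcons_path last_rcons lq pm pq eqxx.
case/lastP: p => [|q x] /=.
  move=> /eqP E; have : size kappa = (size t).+1 by rewrite E.
  by rewrite sznu; lia.
rewrite rcons_path last_rcons => /andP[/andP[pq pm] /eqP E]; subst x.
exists (last kappa q), q; split=> //; first by rewrite mem_interlacings.
have /and4P[/eqP /= [szm] smu _ _] := pm.
by rewrite IHn// ?pq ?eqxx// -szm.
Qed.

Lemma enum_chains_uniq n (kappa nu : seq int) : sorted >=%O nu ->
  size nu = (n + size kappa)%N -> uniq (enum_chains n kappa nu).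
Proof.
elim: n nu => [|n IHn] nu snu sznu /=; first by case: eqP.
case: nu snu sznu => [|a t] // snu sznu /=.
have {}sznu : size t = (n + size kappa)%N by case: sznu.
have sub mu : mu \in interlacings a t ->
    sorted >=%O mu /\ size mu = (n + size kappa)%N.
  rewrite mem_interlacings// => /and4P[/eqP /= [szm] smu _ _].
  by split=> //; rewrite -szm.
apply: allpairs_uniq_dep; first exact: interlacings_uniq.
  by move=> mu /sub[? ?]; exact: IHn.
(* The penultimate signature is recovered as the last element of [p], so different [mu] never
   produce the same chain. *)
have lst mu p : mu \in interlacings a t -> p \in enum_chains n kappa mu ->
    mu = last kappa p.
  by move=> /sub[? ?]; rewrite mem_enum_chains// => /andP[_ /eqP].
move=> _ _ /allpairsPdep[mu [p [hm hp ->]]] /allpairsPdep[mu' [p' [hm' hp' ->]]].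
move=> /= /rcons_inj[E]; subst p'.
by rewrite (lst _ _ hm hp) (lst _ _ hm' hp').
Qed.

Lemma card_chains n (kappa nu : seq int) : sorted >=%O nu ->
  size nu = (n + size kappa)%N ->
  #|` fset_set (chains kappa nu)| = size (enum_chains n kappa nu).
Proof.
move=> snu sznu; rewrite -(undup_id (enum_chains_uniq snu sznu)).
rewrite -(card_fseq (enum_chains n kappa nu)).
congr (#|` _|); apply/fsetP => p.
rewrite in_fset_set; last exact: finite_chains.
rewrite in_fset /= mem_enum_chains//; apply/idP/idP; first by rewrite inE.
by move=> h; rewrite inE.
Qed.

(** * Sums of determinants over interlacing rows *)

Section Determinants.
Variable F : comNzRingType.
Implicit Types (G H : nat -> int -> F) (nu : seq int).

(** The interlacing conditions on different coordinates are independent, so the sum runs over a box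
    and factors. *)
Lemma sum_interlacings_prod H a t :
  \sum_(mu <- interlacings a t) \prod_(r < size t) H r mu`_r =
  \prod_(r < size t) \sum_(x <- int_range t`_r (a :: t)`_r) H r x.
Proof.
elim: t a H => [|b t IHt] a H.
  by rewrite big_seq1 !big_ord0.
rewrite interlacings_cons big_allpairs_dep big_ord_recl /= mulr_suml.
apply: eq_bigr => x _; rewrite -(IHt b (fun r => H r.+1)) mulr_sumr.
by apply: eq_bigr => m _; rewrite big_ord_recl.
Qed.

(** Strictly decreasing coordinates of a signature; [r.+1] compensates for the 0-based index. *)
Definition particle nu (r : nat) : int := nu`_r - r.+1%:Z.

Definition particle_mx N G nu : 'M[F]_N :=
  \matrix_(r < N, c < N) G c (particle nu r).

(** Subtracting from each row the next one clears the constant last column except in the last row;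
    expansion along that column leaves the minor of differences. *)
Lemma det_border N (y : nat -> int) G : (forall p, G N p = 1) ->
  \det (\matrix_(r < N.+1, c < N.+1) G c (y r)) =
  \det (\matrix_(r < N, c < N) (G c (y r) - G c (y r.+1))).
Proof.
move=> G1; set M := \matrix_(_, _) _.
(* [U] performs the row subtractions: it is unipotent upper triangular, with -1 just above the
   diagonal. *)
pose U : 'M[F]_N.+1 := \matrix_(r, s) ((s == r)%:R - (s == r.+1 :> nat)%:R).
have U1 : \det U = 1.
  rewrite -det_tr det_trig; last first.
    apply/is_trig_mxP => i j ij; rewrite !mxE.
    have -> : (i == j) = false by apply/eqP => E; move: ij; rewrite E; lia.
    by rewrite (_ : (_ == _) = false) ?subr0//; apply/eqP; lia.
  apply: big1 => i _; rewrite !mxE eqxx (_ : (_ == _) = false) ?subr0//.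
  by apply/eqP; lia.
rewrite -[LHS]mul1r -U1 -det_mulmx.
have UM (r c : 'I_N.+1) : (U *m M) r c =
    G c (y r) - (if (r < N)%N then G c (y r.+1) else 0).
  rewrite mxE (bigD1 r)//= !mxE eqxx (_ : (_ == _.+1) = false); last first.
    by apply/eqP; lia.
  rewrite subr0 mul1r; congr (_ + _).
  case: ltnP => rN; last first.
    rewrite oppr0 big1// => s sr; rewrite !mxE (negbTE sr).
    rewrite (_ : (_ == _.+1) = false) ?subrr ?mul0r//.
    by apply/eqP; have := ltn_ord s; lia.
  rewrite (bigD1 (Ordinal (rN : (r.+1 < N.+1)%N))) /=; last first.
    by apply/eqP => /(congr1 val) /=; lia.
  rewrite !mxE eqxx (_ : (_ == r) = false); last first.
    by apply/eqP => /(congr1 val) /=; lia.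
  rewrite sub0r mulN1r big1 ?addr0// => s /andP[sr s1]; rewrite !mxE (negbTE sr).
  rewrite (_ : (_ == _.+1) = false) ?subrr ?mul0r//.
  by apply/eqP => E; move/eqP: s1; apply; apply: val_inj.
rewrite (expand_det_col _ ord_max) (bigD1 ord_max)//= big1 ?addr0; last first.
  move=> i iN; rewrite UM /= !G1 ifT ?subrr ?mul0r//.
  have := ltn_ord i; rewrite ltnS leq_eqVlt => /orP[/eqP E|//].
  by case/eqP: iN; apply: val_inj.
rewrite UM ltnn subr0 G1 mul1r /cofactor -signr_odd /= addnn odd_double mul1r.
congr (\det _); apply/matrixP => i j.
transitivity ((U *m M) (lift ord_max i) (lift ord_max j)); first by rewrite !mxE.
by rewrite UM !lift_max ltn_ord mxE.
Qed.

(** In the Leibniz expansion each permutation contributes a sum over a box, which factors into sums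
    that telescope by [GH]. Their endpoints give consecutive particles of [a :: t], as in
    [det_border]. *)
Lemma sum_interlacings_det N G H a t : size t = N -> sorted >=%O (a :: t) ->
  (forall c p, (c < N)%N -> G c p - G c (p - 1) = H c p) ->
  (forall p, G N p = 1) ->
  \sum_(mu <- interlacings a t) \det (particle_mx N H mu) =
  \det (particle_mx N.+1 G (a :: t)).
Proof.
move=> szt st GH G1; subst N.
rewrite /particle_mx det_border// /determinant exchange_big /=.
apply: eq_bigr => s _; rewrite -mulr_sumr; congr (_ * _).
(* [H'] extends the ordinal-indexed entries to indices in [nat]; the default 0 is never
   evaluated. *)
pose H' r x := if (insub r : option 'I_(size t)) is Some i then H (s i) (x - r.+1%:Z) else 0.
transitivity (\sum_(mu <- interlacings a t) \prod_(i < size t) H' i mu`_i).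
  by apply: eq_bigr => mu _; apply: eq_bigr => i _; rewrite mxE /H' valK.
rewrite sum_interlacings_prod; apply: eq_bigr => r _; rewrite mxE.
have ba : t`_r <= (a :: t)`_r.
  by have /(sortedP 0) /(_ r) := st; apply; rewrite ltnS.
rewrite -[X in _ = X - _]/(G (s r) ((a :: t)`_r - r.+1%:Z)).
(* The telescoped sum ends one below the range, at [t_r - 1]; after the shift by [r.+1] this is
   exactly the next particle. *)
have -> : particle (a :: t) r.+1 = t`_r - 1 - r.+1%:Z by rewrite /particle /=; lia.
rewrite -(telescope_int_range (fun x => G (s r) (x - r.+1%:Z)) ba)/=.
apply: eq_bigr => x _; rewrite /H' valK -GH//; congr (_ - G _ _); lia.
Qed.

End Determinants.

(** * The determinant counting chains *)

Section CountingDeterminant.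
Variable F : numFieldType.

(* Iterated summation [n] times of the indicator of [x], read off from the
   offset [m = p - x >= 0]. *)
Definition iter_sum_delta (n m : nat) : F :=
  if n is n'.+1 then 'C(m + n', n')%:R else (m == 0)%:R.

Definition delta_sum (n : nat) (x p : int) : F :=
  if p - x is Posz m then iter_sum_delta n m else 0.

(** Pascal's rule in the offset [p - x], with vanishing below [x] as boundary condition. *)
Lemma delta_sum_diff n x p :
  delta_sum n.+1 x p - delta_sum n.+1 x (p - 1) = delta_sum n x p.
Proof.
rewrite /delta_sum (_ : p - 1 - x = p - x - 1); last by ring.
case: (p - x) => [m|m]; last first.
  by rewrite (_ : Negz m - 1 = Negz m.+1) ?subr0// !NegzE; lia.
case: m => [|m].
  by rewrite add0r subr0 /= add0n; case: n => [|n] /=; rewrite ?binn.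
rewrite (_ : Posz m.+1 - 1 = Posz m) /=; last by lia.
case: n => [|n] /=; first by rewrite !bin0 subrr.
by rewrite addSn binS natrD addrAC subrr add0r addSnnS.
Qed.

Definition rising_poly (m : nat) : {poly F} := \prod_(s < m) ('X + s.+1%:R%:P).

(** The binomial coefficient [z + m] over [m] as a polynomial in [z]; it is the [m]-fold summation
    of the constant 1. *)
Definition binom_poly (m : nat) : {poly F} := m`!%:R^-1 *: rising_poly m.

Lemma rising_polyS m : rising_poly m.+1 = rising_poly m * ('X + m.+1%:R%:P).
Proof. by rewrite /rising_poly big_ord_recr. Qed.

Lemma size_rising_poly m : size (rising_poly m) = m.+1.
Proof.
rewrite /rising_poly (eq_bigr (fun s : 'I_m => 'X - (- s.+1%:R)%:P)); last first.
  by move=> s _; rewrite polyCN opprK.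
by rewrite size_prod_XsubC /index_enum -enumT size_enum_ord.
Qed.

Lemma monic_rising_poly m : rising_poly m \is monic.
Proof. by apply: monic_prod => s _; rewrite -[_%:P]opprK -polyCN monicXsubC. Qed.

Lemma rising_poly_diff m (z : F) : (rising_poly m.+1).[z] -
  (rising_poly m.+1).[z - 1] = m.+1%:R * (rising_poly m).[z].
Proof.
(* Both sides are the Pochhammer product [z (z + 1) ... (z + n)]. *)
have shift n : (z + n%:R) * (rising_poly n).[z - 1] = z * (rising_poly n).[z].
  elim: n => [|n IHn]; first by rewrite /rising_poly !big_ord0 !hornerE; ring.
  rewrite rising_polyS !hornerM !hornerD !hornerX !hornerC.
  transitivity ((z + n.+1%:R) * ((z + n%:R) * (rising_poly n).[z - 1])).
    by rewrite -natr1; ring.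
  by rewrite IHn; ring.
rewrite rising_polyS !hornerM !hornerD !hornerX !hornerC.
rewrite (_ : z - 1 + m.+1%:R = z + m%:R); last by rewrite -natr1; ring.
rewrite [X in _ - X]mulrC shift; ring.
Qed.

Lemma binom_poly_diff m (z : F) :
  (binom_poly m.+1).[z] - (binom_poly m.+1).[z - 1] = (binom_poly m).[z].
Proof.
rewrite /binom_poly !hornerZ -mulrBr rising_poly_diff factS natrM.
by rewrite invfM -mulrA mulrCA mulKf// pnatr_eq0.
Qed.

Lemma binom_poly0 : binom_poly 0 = 1.
Proof. by rewrite /binom_poly fact0 invr1 scale1r /rising_poly big_ord0. Qed.

(** Passing from one level to the next sums every column once more and appends a column of ones. The
    first [K] columns start as indicators at level [K]; column [c >= K] is born constant at level
    [c + 1]. *)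
Definition count_column (K N : nat) (x : nat -> int) (c : nat) (p : int) : F :=
  if (c < K)%N then delta_sum (N - K) (x c) p
  else (binom_poly (N.-1 - c)).[p%:~R].

Lemma count_column_diff K N x c p : (K <= N)%N -> (c < N)%N ->
  count_column K N.+1 x c p - count_column K N.+1 x c (p - 1) =
  count_column K N x c p.
Proof.
move=> KN cN; rewrite /count_column; case: ifP => cK.
  by rewrite subSn// delta_sum_diff.
rewrite [N.+1.-1]/= (_ : N - c = (N.-1 - c).+1)%N; last by lia.
by rewrite rmorphB binom_poly_diff.
Qed.

Lemma sorted_particle (nu : seq int) (i j : nat) : sorted >=%O nu ->
  (i < j)%N -> (j < size nu)%N -> particle nu j < particle nu i.
Proof.
move=> snu ij jn; rewrite /particle.
have : nu`_j <= nu`_i.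
  have := @sorted_leq_nth _ >=%O ge_trans ge_refl 0 nu snu i j.
  by rewrite !inE; apply=> //; [exact: ltn_trans jn|exact: ltnW].
lia.
Qed.

Lemma particle_inj (nu : seq int) (i j : nat) : sorted >=%O nu ->
  (i < size nu)%N -> (j < size nu)%N -> particle nu i = particle nu j -> i = j.
Proof.
move=> snu iN jN E; have [ij|ji|//] := ltngtP i j.
  by have := sorted_particle snu ij jN; rewrite E ltxx.
by have := sorted_particle snu ji iN; rewrite E ltxx.
Qed.

(** The base level of the count, where the only possible chain is the empty one. *)
Lemma det_delta K (kappa nu : seq int) : size kappa = K -> size nu = K ->
  sorted >=%O kappa -> sorted >=%O nu ->
  \det (\matrix_(r < K, c < K) (particle nu r == particle kappa c)%:R) =
  (kappa == nu)%:R :> F.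
Proof.
move=> szk szn sk sn; have [->|ne] := eqVneq.
  rewrite -[RHS](det1 F K); congr (\det _); apply/matrixP => r c; rewrite !mxE.
  suff -> : (particle nu r == particle nu c) = (r == c) by [].
  apply/eqP/eqP => [|->//] E; by apply: val_inj; apply: particle_inj E; rewrite ?szn ?ltn_ord.
(* Two distinct decreasing K-tuples have distinct images, so some row is 0. *)
have [r hr] : exists r : 'I_K, forall c : 'I_K, particle nu r != particle kappa c.
  apply: contrapT => /forallNP H; case/eqP: ne.
  have {}H (r : 'I_K) : exists c : 'I_K, particle nu r == particle kappa c.
    by apply: contrapT => /forallNP h; apply: (H r) => c; exact/negP.
  (* If every row has a match, matching the particles of [nu] with those of [kappa] gives a strictly
     increasing self-map of ['I_K]. Such a map is the identity: [le] inducts upwards from 0, [ge]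
     downwards from the last index. *)
  pose f r := projT1 (cid (H r)).
  have fP (r : 'I_K) : particle nu r = particle kappa (f r).
    by apply/eqP; rewrite /f; case: cid.
  have fh : {homo f : i j / (i < j)%N}.
    move=> i j ij; rewrite ltnNge; apply/negP => ji.
    have : particle nu j < particle nu i by rewrite sorted_particle// szn.
    rewrite !fP; move: ji; rewrite leq_eqVlt => /orP[/eqP/val_inj ->|ji].
      by rewrite ltxx.
    rewrite ltNge => /negP; apply; apply: ltW.
    by rewrite sorted_particle// szk.
  have fid (i : 'I_K) : f i = i.
    have le (m : nat) (mK : (m < K)%N) : (m <= f (Ordinal mK))%N.
      elim: m mK => // m IHm mK; have mK' : (m < K)%N by exact: ltnW.
      by apply: leq_ltn_trans (IHm mK') _; exact: fh.
    have ge (m : nat) (i' : 'I_K) : (i' + m.+1 = K)%N -> (f i' <= i')%N.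
      elim: m i' => [|m IHm] i' im; first by have := ltn_ord (f i'); lia.
      have i1K : (i'.+1 < K)%N by lia.
      have := IHm (Ordinal i1K); have := @fh i' (Ordinal i1K) (ltnSn _).
      move=> /= h1 h2; have {}h2 := h2 ltac:(lia).
      by rewrite -ltnS; exact: leq_trans h1 h2.
    apply: val_inj => /=; apply/eqP; rewrite eqn_leq.
    rewrite (ge (K - i.+1)%N) /=; last by have := ltn_ord i; lia.
    by have := le i (ltn_ord i); rewrite (_ : Ordinal _ = i)//; exact: val_inj.
  apply/esym/(@eq_from_nth _ 0); rewrite ?szk szn// => i iK.
  have := fP (Ordinal iK); rewrite fid /particle /=; lia.
rewrite (expand_det_row _ r) big1// => c _.
by rewrite mxE (negbTE (hr c)) mul0r.
Qed.

Lemma size_enum_chains_det n (kappa nu : seq int) : sorted >=%O kappa ->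
  sorted >=%O nu -> size nu = (n + size kappa)%N ->
  (size (enum_chains n kappa nu))%:R =
  \det (particle_mx (size nu)
          (count_column (size kappa) (size nu) (particle kappa)) nu) :> F.
Proof.
move=> sk; elim: n nu => [|n IHn] nu sn sz.
  rewrite sz add0n /=.
  transitivity ((kappa == nu)%:R : F); first by case: eqP.
  (* At the base level there are no polynomial columns, and [delta_sum 0] is an indicator. *)
  rewrite -(det_delta (erefl _) sz sk sn); congr (\det _).
  apply/matrixP => r c; rewrite !mxE /count_column ltn_ord subnn /delta_sum.
  rewrite -subr_eq0; case: (_ - _) => [m|m] //=.
case: nu sn sz => [|a t] // sn sz.
have szt : size t = (n + size kappa)%N by case: sz.
rewrite -[size (a :: t)]/(size t).+1.
rewrite -(@sum_interlacings_det F (size t)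
  (count_column (size kappa) (size t).+1 (particle kappa))
  (count_column (size kappa) (size t) (particle kappa)))//; last 2 first.
- by move=> c p ct; rewrite count_column_diff// szt leq_addl.
- move=> p; rewrite /count_column ltnNge szt leq_addl /= subnn.
  by rewrite binom_poly0 hornerE.
rewrite -[enum_chains _ _ _]/[seq rcons p (a :: t) | mu <- interlacings a t,
   p <- enum_chains n kappa mu].
rewrite size_allpairs_dep sumnE big_map natr_sum big_seq [RHS]big_seq.
apply: eq_bigr => mu; rewrite mem_interlacings//.
move=> /and4P[/eqP /= [szm] smu _ _].
by rewrite IHn// -szm.
Qed.

End CountingDeterminant.

(** * Divided differences *)

Section Interpolation.
Variables (F : fieldType) (N : nat) (p : 'I_N -> F).
Hypothesis p_inj : injective p.

Definition node_poly (r : 'I_N) : {poly F} := \prod_(s | s != r) ('X - (p s)%:P).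

Definition node_weight (r : 'I_N) : F := \prod_(s | s != r) (p r - p s).

Lemma node_weight_neq0 r : node_weight r != 0.
Proof.
by apply/prodf_neq0 => s sr; rewrite subr_eq0 inj_eq// eq_sym.
Qed.

Lemma horner_node_poly r s :
  (node_poly r).[p s] = if s == r then node_weight r else 0.
Proof.
rewrite /node_poly horner_prod; case: eqVneq => [->|sr].
  by apply: eq_bigr => t _; rewrite !hornerE.
by rewrite (bigD1 s)//= !hornerE subrr mul0r.
Qed.

Lemma size_node_poly r : size (node_poly r) = N.
Proof.
rewrite /node_poly -big_filter size_prod_XsubC -sum1_size big_filter.
by rewrite sum1_card cardC1 card_ord prednK// (leq_trans _ (ltn_ord r)).
Qed.

Lemma monic_node_poly r : node_poly r \is monic.
Proof. by apply: monic_prod => s _; exact: monicXsubC. Qed.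

(** The difference of the two sides has size at most [N] and vanishes at the [N] distinct nodes. *)
Lemma lagrange_interpolation (q : {poly F}) : (size q <= N)%N ->
  q = \sum_r (q.[p r] / node_weight r) *: node_poly r.
Proof.
move=> qN; apply/eqP; rewrite -subr_eq0; apply/eqP.
apply: (@roots_geq_poly_eq0 _ _ [seq p r | r <- enum 'I_N]).
- apply/allP => _ /mapP[s _ ->]; rewrite rootE hornerD hornerN horner_sum.
  rewrite (bigD1 s)//= big1 => [|r rs].
    by rewrite hornerZ horner_node_poly eqxx divfK ?node_weight_neq0// addr0 subrr.
  by rewrite hornerZ horner_node_poly eq_sym (negbTE rs) mulr0.
- by rewrite map_inj_uniq// enum_uniq.
rewrite size_map size_enum_ord; apply: (leq_trans (size_polyD _ _)).
rewrite geq_max qN size_polyN; apply: (leq_trans (size_sum _ _ _)).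
apply/bigmax_leqP => r _; apply: (leq_trans (size_scale_leq _ _)).
by rewrite size_node_poly.
Qed.

(** The argument is a function on the nodes rather than a polynomial, because it is also applied to
    products involving [delta_sum]. *)
Definition divided_diff (q : 'I_N -> F) : F := \sum_r q r / node_weight r.

(** Compare the coefficients of degree [N.-1] in Lagrange's formula, each [node_poly] being monic of
    that degree. *)
Lemma divided_diff_poly (q : {poly F}) : (size q <= N)%N ->
  divided_diff (fun r => q.[p r]) = q`_N.-1.
Proof.
move=> qN; rewrite [in RHS](lagrange_interpolation qN) coef_sum.
apply: eq_bigr => r _; rewrite coefZ.
have -> : (node_poly r)`_N.-1 = lead_coef (node_poly r).
  by rewrite lead_coefE size_node_poly.
by rewrite (eqP (monic_node_poly r)) mulr1.
Qed.

Lemma partial_fractions (q : {poly F}) (z : F) : (size q <= N)%N ->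
  (forall r, z != p r) -> q.[z] / \prod_r (z - p r) =
  \sum_r (q.[p r] / node_weight r) * (z - p r)^-1.
Proof.
move=> qN zp; have zp0 s : z - p s != 0 by rewrite subr_eq0.
rewrite [in LHS](lagrange_interpolation qN) horner_sum mulr_suml.
apply: eq_bigr => r _; rewrite hornerZ -mulrA; congr (_ * _).
rewrite /node_poly horner_prod.
under eq_bigr => s _ do rewrite !hornerE.
rewrite [X in _ / X](bigD1 r)//= invfM mulrCA divff ?mulr1//.
by apply/prodf_neq0 => s _.
Qed.

End Interpolation.

(** Divide by ['X - a 0] and expand the quotient at the shifted nodes. The value of [u 0] is
    recorded because it supplies the diagonal of the change of basis in [det_gap_poly]. *)
Lemma newton_expansion (F : fieldType) (m : nat) (a : nat -> F) (q : {poly F}) :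
  (size q <= m)%N -> exists u : nat -> F,
  u 0 = q.[a 0] /\ q = \sum_(k < m) u k *: \prod_(s < k) ('X - (a s)%:P).
Proof.
elim: m a q => [|m IHm] a q qm.
  move: qm; rewrite leqn0 size_poly_eq0 => /eqP ->.
  by exists (fun=> 0); rewrite horner0 big_ord0.
have /factor_theorem[q' E] : root (q - q.[a 0]%:P) (a 0).
  by rewrite rootE !hornerE subrr.
have sq' : (size q' <= m)%N.
  have [->|q'0] := eqVneq q' 0; first by rewrite size_poly0.
  have : (size (q - q.[a 0]%:P)%R <= m.+1)%N.
    apply: (leq_trans (size_polyD _ _)); rewrite geq_max qm size_polyN.
    by rewrite (leq_trans (size_polyC_leq1 _)).
  by rewrite E size_Mmonic ?monicXsubC// size_XsubC addn2.
have [u [_ Eu]] := IHm (fun k => a k.+1) q' sq'.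
exists (fun k => if k is k'.+1 then u k' else q.[a 0]); split=> //.
rewrite -[LHS](subrK q.[a 0]%:P) E {1}Eu big_ord_recl /= big_ord0 alg_polyC addrC.
congr (_ + _); rewrite mulr_suml; apply: eq_bigr => k _.
by rewrite big_ord_recl /= -scalerAl mulrC.
Qed.

(** * The quotient of two counting determinants *)

Section Ratio.
Variables (F : numFieldType) (K D : nat) (p : 'I_(K + D) -> F).
Hypothesis p_inj : injective p.
Local Notation N := (K + D)%N.
Variable f : nat -> 'I_N -> F.

(* P *m M and P *m B are block lower triangular since divided differences of
   order N.-1 kill polynomials of degree < N.-1. *)
Lemma det_ratio :
  \det (\matrix_(r < N, c < N) if (c < K)%N then f c r
        else (binom_poly F (N.-1 - c)).[p r]) /
  \det (\matrix_(r < N, c < N) (binom_poly F (N.-1 - c)).[p r]) =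
  \det (\matrix_(k < K, j < K)
          divided_diff p (fun r => f j r * (rising_poly F k).[p r])) *
  \prod_(c < K) (N.-1 - c)`!%:R.
Proof.
set M := \matrix_(_, _) _; set B := \matrix_(_, _) _; set Q := \matrix_(_, _) _.
pose P : 'M[F]_N := \matrix_(k, r) ((rising_poly F k).[p r] / node_weight p r).
(* The product polynomial has degree [N - 1 + k - c]: its divided difference vanishes for [k < c]
   and is its leading coefficient for [k = c]. *)
have PB (k c : 'I_N) : (k <= c)%N -> \sum_r P k r * (binom_poly F (N.-1 - c)).[p r]
    = if k == c then (N.-1 - c)`!%:R^-1 else 0.
  move=> kc; pose q := rising_poly F k * binom_poly F (N.-1 - c).
  have sq : size q = (N + k - c)%N.
    rewrite /q /binom_poly -scalerAr size_scale ?invr_eq0 ?pnatr_eq0 -?lt0n ?fact_gt0//.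
    rewrite size_monicM ?monic_rising_poly// ?size_rising_poly; last first.
      by rewrite -size_poly_eq0 size_rising_poly.
    by have := ltn_ord c; lia.
  transitivity q`_N.-1.
    rewrite -(divided_diff_poly p_inj); last by rewrite sq; lia.
    apply: eq_bigr => r _; rewrite mxE hornerM; ring.
  case: eqVneq => [E|ne]; last first.
    rewrite nth_default// sq; have : (k != c :> nat) by [].
    by have := ltn_ord c; lia.
  rewrite /q /binom_poly -E -scalerAr coefZ -[RHS]mulr1; congr (_ * _).
  have /monicP <- : rising_poly F k * rising_poly F (N.-1 - k) \is monic.
    by rewrite rpredM// monic_rising_poly.
  rewrite lead_coefE size_monicM ?monic_rising_poly ?size_rising_poly//; last first.
    by rewrite -size_poly_eq0 size_rising_poly.
  by congr nth; have := ltn_ord k; lia.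
have detPB : \det P * \det B = \prod_(c < N) (N.-1 - c)`!%:R^-1.
  rewrite -det_mulmx det_trig.
    apply: eq_bigr => c _; have := PB c c (leqnn c); rewrite eqxx => <-.
    by rewrite mxE; apply: eq_bigr => r _; rewrite !mxE.
  apply/is_trig_mxP => k c kc; rewrite mxE.
  transitivity (\sum_r P k r * (binom_poly F (N.-1 - c)).[p r]).
    by apply: eq_bigr => r _; rewrite !mxE.
  by rewrite PB 1?ltnW// -val_eqE /= ltn_eqF.
have detPM : \det P * \det M = \det Q * \prod_(c < D) (D.-1 - c)`!%:R^-1.
  rewrite -det_mulmx -[P *m M]submxK.
  have -> : ursubmx (P *m M) = 0.
    apply/matrixP => k c; rewrite !mxE.
    transitivity (\sum_r P (lshift D k) r * (binom_poly F (N.-1 - rshift K c)).[p r]).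
      by apply: eq_bigr => r _; rewrite !mxE /= ltnNge leq_addr.
    rewrite PB /=; last by have := ltn_ord k; lia.
    by rewrite eq_lrshift.
  rewrite det_lblock; congr (_ * _).
    congr (\det _); apply/matrixP => k j; rewrite !mxE.
    by apply: eq_bigr => r _; rewrite !mxE /= ltn_ord; ring.
  have drE (k c : 'I_D) : (k <= c)%N -> drsubmx (P *m M) k c =
      if k == c then (D.-1 - c)`!%:R^-1 else 0.
    move=> kc; rewrite !mxE.
    transitivity (\sum_r P (rshift K k) r * (binom_poly F (N.-1 - rshift K c)).[p r]).
      by apply: eq_bigr => r _; rewrite !mxE /= ltnNge leq_addr.
    rewrite PB /= ?leq_add2l// eq_rshift.
    by rewrite (_ : N.-1 - (K + c) = D.-1 - c)%N//; have := ltn_ord c; lia.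
  rewrite det_trig; first by apply: eq_bigr => c _; rewrite drE// eqxx.
  by apply/is_trig_mxP => k c kc; rewrite drE 1?ltnW// -val_eqE /= ltn_eqF.
have fact_neq0 (n : nat) : n`!%:R != 0 :> F by rewrite pnatr_eq0 -lt0n fact_gt0.
have PB0 : \det P * \det B != 0.
  by rewrite detPB; apply/prodf_neq0 => c _; rewrite invr_eq0.
have /andP[P0 B0] : (\det P != 0) && (\det B != 0) by rewrite -negb_or -mulf_eq0.
have -> : \det M / \det B = (\det P * \det M) / (\det P * \det B).
  by rewrite -mulf_div divff// mul1r.
(* The factorials indexed by [c >= K] cancel those of the lower right block of [P *m M]. *)
rewrite detPM detPB big_split_ord /= -mulrA; congr (_ * _).
rewrite [X in _ / (_ * X)](eq_bigr (fun c : 'I_D => (D.-1 - c)`!%:R^-1)); last first.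
  by move=> c _; rewrite (_ : N.-1 - (K + c) = D.-1 - c)%N//; have := ltn_ord c; lia.
rewrite invfM mulrCA divff ?mulr1; last first.
  by apply/prodf_neq0 => c _; rewrite invr_eq0.
by rewrite -prodfV; apply: eq_bigr => c _; rewrite invrK.
Qed.

(* (z + 1)_N / (z + i + 1)_(D + 1), as a polynomial. *)
Definition gap_poly (i : nat) : {poly F} :=
  rising_poly F i * \prod_(i + D.+1 <= s < N) ('X + s.+1%:R%:P).

(** Each [gap_poly i] is a combination of the [rising_poly k] with [k >= i], so the change of basis
    is triangular. Its diagonal entry is [(N - 1 - i)! / D!], and the factor [D!] clears the
    denominator. *)
Lemma det_gap_poly :
  \det (\matrix_(i < K, j < K) (D`!%:R *
          divided_diff p (fun r => f j r * (gap_poly i).[p r]))) =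
  \det (\matrix_(k < K, j < K)
          divided_diff p (fun r => f j r * (rising_poly F k).[p r])) *
  \prod_(c < K) (N.-1 - c)`!%:R.
Proof.
set A := \matrix_(_, _) _; set Q := \matrix_(_, _) _.
have ex (i : 'I_K) : exists v : nat -> F,
    [/\ forall k, (k < i)%N -> v k = 0,
        D`!%:R * v i = (N.-1 - i)`!%:R
      & gap_poly i = \sum_(k < K) v k *: rising_poly F k].
  pose t : {poly F} := \prod_(i + D.+1 <= s < N) ('X + s.+1%:R%:P).
  have iK := ltn_ord i.
  have st : (size t <= K - i)%N.
    rewrite /t (eq_bigr (fun s => 'X - (- s.+1%:R)%:P)); last first.
      by move=> s _; rewrite polyCN opprK.
    by rewrite size_prod_XsubC size_iota; lia.
  (* The nodes continue the roots of [rising_poly i], so multiplying it by the Newton basis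
     polynomial of index [k] gives [rising_poly (i + k)]. *)
  have [u [u0 Et]] := newton_expansion (fun s => - (i + s).+1%:R) st.
  exists (fun k => if (k < i)%N then 0 else u (k - i)%N); split.
  - by move=> k ->.
  - rewrite ltnn subnn u0 /t horner_prod addn0.
    under eq_big_nat => s /andP[s1 _].
      rewrite !hornerE (_ : _ + _ = (s - i)%:R); last first.
        by rewrite natrB; [rewrite -!natr1; ring|lia].
      over.
    rewrite -natr_prod -natrM; congr (_%:R).
    (* At the first node the factors of [t] become [D + 1, ..., N - 1 - i]; induction on their
       number [K - 1 - i] yields the quotient of factorials. *)
    have -> : (N.-1 - i = D + (K.-1 - i))%N by lia.
    rewrite (_ : N = (i + D.+1) + (K.-1 - i))%N; last by lia.
    elim: (K.-1 - i)%N => [|n IHn]; first by rewrite addn0 big_geq// muln1 addn0.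
    rewrite [(i + D.+1 + _)%N]addnS big_nat_recr ?leq_addr//= mulnA IHn.
    rewrite [(D + n.+1)%N]addnS factS mulnC.
    by congr (_ * _)%N; lia.
  rewrite /gap_poly -/t Et mulr_sumr.
  have -> : \sum_(k < K) (if (k < i)%N then 0 else u (k - i)%N) *: rising_poly F k
     = \sum_(0 <= k < K) (if (k < i)%N then 0 else u (k - i)%N) *: rising_poly F k.
    by rewrite big_mkord.
  rewrite (big_cat_nat _ (n := i))//=; last exact: ltnW.
  rewrite [X in _ = X + _]big_nat [X in _ = X + _]big1 ?add0r; last first.
    by move=> k /andP[_ ->]; rewrite scale0r.
  rewrite -[X in _ = \sum_(X <= _ < _) _]add0n big_addn big_mkord.
  apply: eq_bigr => k _.
  rewrite ltnNge leq_addl /= addnK -scalerAr; congr (_ *: _).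
  rewrite addnC /rising_poly big_split_ord /=; congr (_ * _).
  by apply: eq_bigr => s _; rewrite polyCN opprK.
pose v i := projT1 (cid (ex i)).
pose T : 'M[F]_K := \matrix_(i, k) (D`!%:R * v i k).
have -> : A = T *m Q.
  apply/matrixP => i j; rewrite !mxE.
  have [_ _ ->] := projT2 (cid (ex i)); rewrite -/(v i).
  rewrite /divided_diff mulr_sumr.
  under eq_bigr => r _.
    rewrite horner_sum mulr_sumr mulr_suml mulr_sumr; over.
  rewrite exchange_big /=; apply: eq_bigr => k _; rewrite !mxE mulr_sumr.
  by apply: eq_bigr => r _; rewrite hornerZ; ring.
rewrite det_mulmx mulrC; congr (_ * _).
rewrite -det_tr det_trig.
  by apply: eq_bigr => i _; rewrite !mxE; have [_ -> _] := projT2 (cid (ex i)).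
apply/is_trig_mxP => k i ki; rewrite !mxE.
by have [v0 _ _] := projT2 (cid (ex i)); rewrite [v _ _]v0// mulr0.
Qed.

End Ratio.

(** * Integration along piecewise C^1 curves *)

Import numFieldNormedType.Exports.
Import Normc.

Local Open Scope classical_set_scope.
Local Open Scope ring_scope.
Local Open Scope complex_scope.

Section RealVariable.
Context {R : realType}.
Implicit Types (f h u : R -> R) (s t : R) (ts : seq R).
Local Notation mu := (@lebesgue_measure R).

Lemma within_continuousM (A : set R) f h : {within A, continuous f} ->
  {within A, continuous h} -> {within A, continuous (fun x => f x * h x)}.
Proof. by move=> cf ch x; apply: cvgM; [exact: cf|exact: ch]. Qed.

Lemma within_continuousV (A : set R) f : {within A, continuous f} ->
  (forall x, A x -> f x != 0) -> {within A, continuous (fun x => (f x)^-1)}.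
Proof.
move=> cf f0; apply/subspace_continuousP => x Ax.
by apply: cvgV; [exact: f0|have /subspace_continuousP := cf; exact].
Qed.

(** The continuous extension [h] of the derivative is carried explicitly, so that the calculus rules
    compute it. *)
Definition C1_with s t f h : Prop :=
  [/\ {within `[s, t], continuous f}, {within `[s, t], continuous h} &
      {in `]s, t[, forall x : R, is_derive x (1 : R) f (h x)}].

Lemma C1_on_with s t f : C1_on s t f -> exists h, C1_with s t f h /\
  {in `]s, t[, forall x, derive1 f x = h x}.
Proof.
move=> [cf df [h ch fh]]; exists h; split=> //; split=> // x xst.
by apply: DeriveDef; [exact: df|rewrite -derive1E fh].
Qed.

Lemma C1_withB s t f (a : R) h : C1_with s t f h ->
  C1_with s t (fun x => f x - a) h.
Proof.
move=> [cf ch d]; split=> //.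
  by move=> x; apply: cvgB; [exact: cf|exact: cvg_cst].
move=> x xst; have dx := d x xst.
rewrite -[h x]subr0; apply: is_deriveB.
Qed.

Lemma C1_withN s t f h : C1_with s t f h ->
  C1_with s t (fun x => - f x) (fun x => - h x).
Proof.
move=> [cf ch d]; split.
- by move=> x; apply: cvgN; exact: cf.
- by move=> x; apply: cvgN; exact: ch.
by move=> x xst; have dx := d x xst; apply: is_deriveN.
Qed.

Lemma C1_withD s t f h f' h' : C1_with s t f f' -> C1_with s t h h' ->
  C1_with s t (fun x => f x + h x) (fun x => f' x + h' x).
Proof.
move=> [cf cf' df] [ch ch' dh]; split.
- by move=> x; apply: cvgD; [exact: cf|exact: ch].
- by move=> x; apply: cvgD; [exact: cf'|exact: ch'].
by move=> x xst; apply: is_deriveD; [exact: df|exact: dh].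
Qed.

Lemma C1_withM s t f h f' h' : C1_with s t f f' -> C1_with s t h h' ->
  C1_with s t (fun x => f x * h x) (fun x => f x * h' x + h x * f' x).
Proof.
move=> [cf cf' df] [ch ch' dh]; split.
- exact: within_continuousM.
- by move=> x; apply: cvgD; apply: within_continuousM.
by move=> x xst; apply: is_deriveM; [exact: df|exact: dh].
Qed.

Lemma C1_withV s t f f' : C1_with s t f f' ->
  (forall x, x \in `[s, t] -> f x != 0) ->
  C1_with s t (fun x => (f x)^-1) (fun x => - ((f x)^-1 * (f x)^-1) * f' x).
Proof.
move=> [cf cf' df] f0.
have cV : {within `[s, t], continuous (fun x => (f x)^-1)}.
  by apply: within_continuousV => // x xst; exact: f0.
split=> //.
  have cVV := within_continuousM cV cV.
  by apply: within_continuousM => // x; apply: cvgN; exact: cVV.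
move=> x xst; have [dx <-] := df x xst.
have fx0 : f x != 0 by apply: f0; exact: subset_itv_oo_cc.
apply: DeriveDef; first exact: derivableV.
by rewrite deriveV// -invfM -expr2.
Qed.

(** Agreement of [u] with [h] is asked only inside the interval: at a breakpoint [derive1] may be a
    default value, and endpoints have measure zero. *)
Lemma C1_with_FTC s t f h u : s < t -> C1_with s t f h ->
  {in `]s, t[, u =1 h} -> \int[mu]_(x in `[s, t]) u x = f t - f s.
Proof.
move=> st [cf ch df] uh.
have mh : measurable_fun `]s, t[ (EFin \o h).
  apply/measurable_EFinP.
  apply: (@measurable_funS _ _ _ _ `[s, t]) => //; first exact: subset_itv_oo_cc.
  exact: subspace_continuous_measurable_fun.
have E : (\int[mu]_(x in `]s, t[) (u x)%:E = \int[mu]_(x in `]s, t[) (h x)%:E)%E.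
  by apply: eq_integral => x; rewrite inE => xst; rewrite uh.
rewrite /Rintegral integral_itv_bndoo; last first.
  by apply: (eq_measurable_fun _ _ mh) => x; rewrite inE => xst /=; rewrite uh.
rewrite E -(@integral_itv_bndoo _ _ _ _ true false)//.
rewrite (continuous_FTC2 st ch (F := f)) -?EFinB//.
  have /(continuous_within_itvP _ st)[_ ? ?] := cf.
  by split=> // x xst; have [] := df x xst.
by move=> x xst; rewrite derive1E; have [_ ->] := df x xst.
Qed.

Lemma piece_induction (Q : R -> R -> Prop) ts (a : R) :
  (forall a, Q a a) ->
  (forall a b c, a < b -> b <= c -> Q a b -> Q b c -> Q a c) ->
  (forall k, (k < size ts)%N -> Q (a :: ts)`_k ts`_k) ->
  path <%R a ts -> Q a (last a ts) /\ a <= last a ts.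
Proof.
move=> Q0 Qc; elim: ts a => [|b ts IHts] a Qk /=; first by rewrite lexx.
move=> /andP[ab pb].
have [Qb bl] : Q b (last b ts) /\ b <= last b ts.
  by apply: IHts => // k kts; exact: (Qk k.+1).
split; last by rewrite (le_trans (ltW ab)).
by apply: (Qc a b) => //; exact: (Qk 0%N).
Qed.

Lemma path_subitv ts (a : R) (k : nat) : path <%R a ts -> (k < size ts)%N ->
  a <= (a :: ts)`_k /\ ts`_k <= last a ts.
Proof.
elim: ts a k => // b ts IHts a [|k] /= /andP[ab pb] kts.
  split=> //; have [] // := @piece_induction (fun _ _ => True) ts b.
by have [bk kl] := IHts b k pb kts; rewrite (le_trans (ltW ab)).
Qed.

(** A condition that survives gluing at breakpoints, where continuity may fail, and that suffices
    for integrability on a segment. *)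
Definition bounded_measurable (D : set R) u : Prop :=
  measurable_fun D u /\ exists M, forall x, D x -> `|u x| <= M.

Lemma bounded_measurableU (A B : set R) u : measurable A -> measurable B ->
  bounded_measurable A u -> bounded_measurable B u ->
  bounded_measurable (A `|` B) u.
Proof.
move=> mA mB [muA [MA hA]] [muB [MB hB]]; split; first exact/measurable_funU.
exists (Num.max MA MB) => x [Ax|Bx]; rewrite le_max.
  by rewrite hA.
by rewrite hB// orbT.
Qed.

Lemma bounded_measurable_set1 (a : R) u : bounded_measurable [set a] u.
Proof.
by split; [exact: measurable_fun_set1|exists `|u a| => x ->].
Qed.

(** The extreme value theorem bounds [h], hence [u] inside; the two endpoints are added as
    singletons. *)
Lemma bounded_measurable_piece s t u h : s <= t ->
  {within `[s, t], continuous h} -> {in `]s, t[, u =1 h} ->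
  bounded_measurable `[s, t] u.
Proof.
move=> st ch uh.
have [M hM] : exists M, forall x, x \in `[s, t] -> `|h x| <= M.
  have [c _ cmax] := EVT_max st ch; have [d _ dmin] := EVT_min st ch.
  exists (Num.max `|h c| `|h d|) => x xst; rewrite le_max !ler_norml.
  have := cmax x xst; have := dmin x xst.
  have := ler_norm (h c); have := lerNnormlW (lexx `|h d|).
  move=> h1 h2 h3 h4; have [h0|h0] := leP 0 (h x).
    apply/orP; left; apply/andP; split; first exact: le_trans h0.
    exact: le_trans h2.
  apply/orP; right; apply/andP; split; first exact: le_trans h3.
  by apply: (le_trans (ltW h0)).
have oo : bounded_measurable `]s, t[ u.
  split.
    have mh : measurable_fun `]s, t[ h.
      apply: (@measurable_funS _ _ _ _ `[s, t]) => //; first exact: subset_itv_oo_cc.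
      exact: subspace_continuous_measurable_fun.
    by apply: (eq_measurable_fun _ _ mh) => x; rewrite inE => xst /=; rewrite uh.
  by exists M => x xst; rewrite uh//; apply: hM; exact: subset_itv_oo_cc.
have sub : `[s, t] `<=` `]s, t[ `|` ([set s] `|` [set t]).
  move=> x /=; rewrite in_itv /= => /andP[].
  rewrite le_eqVlt => /predU1P[->|sx]; first by right; left.
  rewrite le_eqVlt => /predU1P[->|xt]; first by right; right.
  by left; rewrite in_itv /= sx.
have [mU [M' hM']] : bounded_measurable (`]s, t[ `|` ([set s] `|` [set t])) u.
  apply: bounded_measurableU => //; first exact: measurableU.
  by apply: bounded_measurableU => //; exact: bounded_measurable_set1.
split; last by exists M' => x xst; exact/hM'/sub.
by apply: measurable_funS mU => //; apply: measurableU => //; exact: measurableU.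
Qed.

Lemma bounded_measurable_path ts (a : R) u : path <%R a ts ->
  (forall k, (k < size ts)%N ->
    exists2 h, {within `[(a :: ts)`_k, ts`_k], continuous h} &
      {in `](a :: ts)`_k, ts`_k[, u =1 h}) ->
  bounded_measurable `[a, last a ts] u.
Proof.
move=> pa hu.
pose Q s t := bounded_measurable `[s, t] u.
have [//] : Q a (last a ts) /\ a <= last a ts.
apply: piece_induction pa.
- by move=> b; rewrite /Q set_itv1; exact: bounded_measurable_set1.
- move=> b c d bc cd Qbc Qcd; rewrite /Q.
  have -> : `[b, d]%classic = `[b, c] `|` `[c, d].
    apply/seteqP; split => x /=; rewrite !in_itv /=.
      move=> /andP[bx xd]; have [xc|cx] := leP x c; [left|right].
        by rewrite bx.
      by rewrite (ltW cx).
    by move=> [] /andP[h1 h2]; apply/andP; split=> //; lra.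
  exact: bounded_measurableU.
move=> k kts; have [h ch uh] := hu k kts; rewrite /Q.
have [le|gt] := leP (a :: ts)`_k ts`_k; first exact: bounded_measurable_piece ch uh.
rewrite set_itv_ge ?bnd_simp -?ltNge//.
by split; [exact: measurable_fun_set0|exists 0].
Qed.

Lemma bounded_measurable_integrable (a b : R) u :
  bounded_measurable `[a, b] u -> mu.-integrable `[a, b] (EFin \o u).
Proof.
move=> [mu_ [M hM]]; apply: measurable_bounded_integrable => //.
  by apply: compact_finite_measure; exact: segment_compact.
exists M; split; first exact: num_real.
by move=> x Mx y yab /=; apply: le_trans (hM y yab) (ltW Mx).
Qed.

(** A single primitive [f] serves all pieces, so its values at interior breakpoints telescope. *)
Lemma FTC_path ts (a : R) f u : path <%R a ts ->
  bounded_measurable `[a, last a ts] u ->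
  (forall k, (k < size ts)%N -> exists2 h, C1_with (a :: ts)`_k ts`_k f h &
      {in `](a :: ts)`_k, ts`_k[, u =1 h}) ->
  \int[mu]_(x in `[a, last a ts]) u x = f (last a ts) - f a.
Proof.
elim: ts a => [|b ts IHts] a pa bm hu /=.
  by rewrite set_itv1 Rintegral_set1 subrr.
move: pa => /= /andP[ab pb].
have bl : b <= last b ts.
  have [] // := @piece_induction (fun _ _ => True) ts b.
have bmb : bounded_measurable `[b, last b ts] u.
  have [m [M hM]] := bm; split.
    apply: measurable_funS m => //; apply: subset_itvr.
    by rewrite bnd_simp ltW.
  exists M => x; rewrite /= in_itv /= => /andP[bx xl]; apply: hM.
  by rewrite /= in_itv /= (le_trans (ltW ab)).
have itv := bounded_measurable_integrable bm.
have itb := bounded_measurable_integrable bmb.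
have := @Rintegral_itvB _ u (BLeft a) (BRight (last b ts)) b itv.
rewrite !bnd_simp => /(_ (ltW ab) bl).
rewrite Rintegral_itv_obnd_cbnd; last first.
  by apply: integrableS itb => //; apply: subset_itvr; rewrite bnd_simp.
rewrite (IHts b pb bmb); last by move=> k kts; exact: (hu k.+1).
have [h h1 h2] := hu 0%N isT.
rewrite (C1_with_FTC ab h1 h2) => E.
by rewrite -[LHS](subrK (f b - f a)) E; ring.
Qed.

End RealVariable.

(** * Complex-valued integrals over the unit interval *)

Section ComplexIntegral.
Context {R : realType}.
Implicit Types (h k : R -> R[i]) (z w : R[i]).
Local Notation mu := (@lebesgue_measure R).
Local Notation Re := (@complex.Re R).
Local Notation Im := (@complex.Im R).

Lemma normc_ge0 z : 0 <= normc z.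
Proof. by case: z => a b; exact: sqrtr_ge0. Qed.

Lemma le_Re_normc z : `|Re z| <= normc z.
Proof.
by case: z => a b /=; rewrite -sqrtr_sqr ler_wsqrtr// lerDl sqr_ge0.
Qed.

Lemma le_Im_normc z : `|Im z| <= normc z.
Proof.
by case: z => a b /=; rewrite -sqrtr_sqr ler_wsqrtr// lerDr sqr_ge0.
Qed.

Lemma normc_le_ReIm z : normc z <= `|Re z| + `|Im z|.
Proof.
case: z => a b /=; rewrite -[leRHS]ger0_norm ?addr_ge0// -sqrtr_sqr ler_wsqrtr//.
by rewrite sqrrD !real_normK ?num_real// addrAC lerDl mulrn_wge0.
Qed.

Lemma normc_triangle w z : normc (w + z) <= normc w + normc z.
Proof. exact: le_normcD. Qed.

Lemma normc_distC w z : normc (w - z) = normc (z - w).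
Proof. by rewrite -opprB normcN. Qed.

Lemma normc_lt0_eq z : (forall e : R, 0 < e -> normc z <= e) -> z = 0.
Proof.
move=> h; apply: eq0_normc; apply/eqP; rewrite eq_le normc_ge0 andbT leNgt.
by apply/negP => z0; have := h (normc z / 2) ltac:(lra); lra.
Qed.

Lemma measurable_invr : measurable_fun [set: R] (@GRing.inv R).
Proof.
rewrite -(setUv [set 0 : R]); apply/measurable_funU => //.
  by apply: measurableC; exact: measurable_set1.
split; first exact: measurable_fun_set1.
apply: open_continuous_measurable_fun.
  rewrite (_ : ~` _ = [set x | x != 0 :> R]); first exact: open_neq.
  by apply/seteqP; split=> x /= /eqP.
by move=> x; rewrite inE /= => /eqP x0; exact: inv_continuous.
Qed.

Definition cmeasurable h :=
  measurable_fun `[0 : R, 1] (Re \o h) /\ measurable_fun `[0 : R, 1] (Im \o h).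

Lemma cmeasurable_cst w : cmeasurable (fun=> w).
Proof. by split; exact: measurable_cst. Qed.

Lemma cmeasurableD h k : cmeasurable h -> cmeasurable k ->
  cmeasurable (fun t => h t + k t).
Proof.
move=> [h1 h2] [k1 k2]; split.
  rewrite (_ : _ \o _ = (Re \o h) \+ (Re \o k)); first exact: measurable_funD.
  by apply/funext => t /=; case: (h t) (k t) => ? ? [].
rewrite (_ : _ \o _ = (Im \o h) \+ (Im \o k)); first exact: measurable_funD.
by apply/funext => t /=; case: (h t) (k t) => ? ? [].
Qed.

Lemma cmeasurableM h k : cmeasurable h -> cmeasurable k ->
  cmeasurable (fun t => h t * k t).
Proof.
move=> [h1 h2] [k1 k2]; split.
  rewrite (_ : _ \o _ = ((Re \o h) \* (Re \o k)) \- ((Im \o h) \* (Im \o k))).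
    by apply: measurable_funB; exact: measurable_funM.
  by apply/funext => t /=; case: (h t) (k t) => ? ? [].
rewrite (_ : _ \o _ = ((Re \o h) \* (Im \o k)) \+ ((Im \o h) \* (Re \o k))).
  by apply: measurable_funD; exact: measurable_funM.
by apply/funext => t /=; case: (h t) (k t) => ? ? [].
Qed.

(** Times where [h] vanishes are covered with the convention [0^-1 = 0]; the denominators in [A_fun]
    may vanish on the contour. *)
Lemma cmeasurableV h : cmeasurable h -> cmeasurable (fun t => (h t)^-1).
Proof.
move=> [h1 h2].
have mn : measurable_fun `[0 : R, 1] (fun t => (Re (h t) ^+ 2 + Im (h t) ^+ 2)^-1).
  apply: (measurableT_comp measurable_invr).
  by apply: measurable_funD; apply: measurable_funX.
split.
  rewrite (_ : _ \o _ = (Re \o h) \* (fun t => (Re (h t) ^+ 2 + Im (h t) ^+ 2)^-1)).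
    exact: measurable_funM.
  by apply/funext => t /=; case: (h t).
rewrite (_ : _ \o _ = -%R \o ((Im \o h) \* (fun t => (Re (h t) ^+ 2 + Im (h t) ^+ 2)^-1))).
  apply: measurableT_comp; first exact: oppr_measurable.
  exact: measurable_funM.
by apply/funext => t /=; case: (h t).
Qed.

Lemma cmeasurable_prod n (h : 'I_n -> R -> R[i]) :
  (forall i, cmeasurable (h i)) -> cmeasurable (fun t => \prod_(i < n) h i t).
Proof.
elim: n h => [|n IHn] h mh.
  under eq_fun do rewrite big_ord0; exact: cmeasurable_cst.
under eq_fun do rewrite big_ord_recl; apply: cmeasurableM => //.
exact: IHn.
Qed.

Definition cbounded h := exists M, forall t, t \in `[0, 1] -> normc (h t) <= M.

(** A class of integrands stable under sums, products and inverses bounded away from 0, on which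
    [integral01] is linear. *)
Definition admissible h := cmeasurable h /\ cbounded h.

Lemma admissible_cst w : admissible (fun=> w).
Proof. by split; [exact: cmeasurable_cst|exists (normc w)]. Qed.

Lemma admissibleD h k : admissible h -> admissible k ->
  admissible (fun t => h t + k t).
Proof.
move=> [mh [M hM]] [mk [L hL]]; split; first exact: cmeasurableD.
exists (M + L) => t t01; apply: (le_trans (normc_triangle _ _)).
by rewrite lerD ?hM ?hL.
Qed.

Lemma admissibleM h k : admissible h -> admissible k ->
  admissible (fun t => h t * k t).
Proof.
move=> [mh [M hM]] [mk [L hL]]; split; first exact: cmeasurableM.
by exists (M * L) => t t01; rewrite normcM ler_pM ?normc_ge0 ?hM ?hL.
Qed.

Lemma admissibleV h (d : R) : 0 < d ->
  (forall t, t \in `[0, 1] -> d <= normc (h t)) -> admissible h ->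
  admissible (fun t => (h t)^-1).
Proof.
move=> d0 hd [mh _]; split; first exact: cmeasurableV.
by exists d^-1 => t t01; rewrite normcV lef_pV2 ?posrE ?(lt_le_trans d0) ?hd.
Qed.

Lemma admissible_sum (I : eqType) (r : seq I) (h : I -> R -> R[i]) :
  (forall i, admissible (h i)) -> admissible (fun t => \sum_(i <- r) h i t).
Proof.
move=> ah; elim: r => [|i r IHr].
  under eq_fun do rewrite big_nil; exact: admissible_cst.
by under eq_fun do rewrite big_cons; exact: admissibleD.
Qed.

Lemma admissible_bounded_measurable h : admissible h ->
  bounded_measurable `[0, 1] (Re \o h) /\ bounded_measurable `[0, 1] (Im \o h).
Proof.
move=> [[h1 h2] [M hM]]; split; split=> //; exists M => t t01 /=.
  by rewrite (le_trans (le_Re_normc _))// hM.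
by rewrite (le_trans (le_Im_normc _))// hM.
Qed.

Lemma bounded_measurable_admissible h : bounded_measurable `[0, 1] (Re \o h) ->
  bounded_measurable `[0, 1] (Im \o h) -> admissible h.
Proof.
move=> [m1 [M1 b1]] [m2 [M2 b2]]; split=> //; exists (M1 + M2) => t t01.
by rewrite (le_trans (normc_le_ReIm _))// lerD// ?b1 ?b2.
Qed.

Lemma admissible_integrable h : admissible h ->
  mu.-integrable `[0, 1] (EFin \o (Re \o h)) /\
  mu.-integrable `[0, 1] (EFin \o (Im \o h)).
Proof.
by move=> /admissible_bounded_measurable[? ?]; split;
  exact: bounded_measurable_integrable.
Qed.

Lemma integral01D h k : admissible h -> admissible k ->
  integral01 (fun t => h t + k t) = integral01 h + integral01 k.
Proof.
move=> /admissible_integrable[h1 h2] /admissible_integrable[k1 k2].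
rewrite /integral01 -[RHS]/(_ +i* _) -!RintegralD//.
by congr (_ +i* _); apply: eq_Rintegral => t _ /=; case: (h t) (k t) => ? ? [].
Qed.

Lemma integral01Z w h : admissible h ->
  integral01 (fun t => w * h t) = w * integral01 h.
Proof.
move=> /admissible_integrable[h1 h2]; case: w => a b.
have mZ (c : R) (u : R -> R) : mu.-integrable `[0, 1] (EFin \o u) ->
    mu.-integrable `[0, 1] (EFin \o (fun t => c * u t)).
  by move=> iu; apply: (integrableZl _ c iu).
rewrite /integral01 -[RHS]/(_ +i* _) -!RintegralZl//.
rewrite -RintegralB ?mZ// -RintegralD ?mZ//.
by congr (_ +i* _); apply: eq_Rintegral => t _ /=; case: (h t).
Qed.

Lemma integral01_0 : integral01 (fun=> 0) = 0 :> R[i].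
Proof.
by have := integral01Z 0 (admissible_cst 0); rewrite !mul0r.
Qed.

Lemma integral01_sum (I : eqType) (r : seq I) (h : I -> R -> R[i]) :
  (forall i, admissible (h i)) ->
  integral01 (fun t => \sum_(i <- r) h i t) = \sum_(i <- r) integral01 (h i).
Proof.
move=> ah; elim: r => [|i r IHr].
  under eq_fun do rewrite big_nil; by rewrite integral01_0 big_nil.
under eq_fun do rewrite big_cons; rewrite big_cons integral01D ?IHr//.
exact: admissible_sum.
Qed.

(** The factor 2 comes from bounding the real and imaginary parts separately. *)
Lemma normc_integral01 h (M : R) : admissible h ->
  (forall t, t \in `[0, 1] -> normc (h t) <= M) -> normc (integral01 h) <= 2 * M.
Proof.
move=> ah hM; have [i1 i2] := admissible_integrable ah.
have bnd (u : R -> R) : mu.-integrable `[0, 1] (EFin \o u) ->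
    (forall t, t \in `[0, 1] -> `|u t| <= M) ->
    `|(\int[mu]_(t in `[0, 1]) u t)%R| <= M.
  move=> iu hu; apply: (le_trans (le_normr_Rintegral _ iu)) => //.
  have cM : mu.-integrable `[0, 1] (EFin \o (fun=> M)).
    apply: bounded_measurable_integrable; split; first exact: measurable_cst.
    by exists `|M|.
  apply: (@le_trans _ _ (\int[mu]_(t in `[0, 1]) M)).
    apply: le_Rintegral => //; first exact: integrable_norm.
  have := @lebesgue_measure_itv R `[0, 1]%R.
  rewrite /= lte_fin ltr01 oppr0 adde0 => mu1.
  by rewrite Rintegral_cst// [X in fine X]mu1 mulr1.
apply: (le_trans (normc_le_ReIm _)); rewrite mulr2n mulrDl mul1r.
by apply: lerD; apply: bnd => // t t01; rewrite (le_trans _ (hM t t01))//;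
  [exact: le_Re_normc|exact: le_Im_normc].
Qed.

Lemma eq_integral01_finite h k (S : set R) : finite_set S ->
  cmeasurable h -> cmeasurable k ->
  (forall t, t \in `[0, 1] -> ~ S t -> h t = k t) -> integral01 h = integral01 k.
Proof.
move=> fS [h1 h2] [k1 k2] hk.
have mS : measurable S by apply: countable_measurable => //; exact: finite_set_countable.
have S0 : mu S = 0.
  by apply: countable_lebesgue_measure0; exact: finite_set_countable.
have aeS (u v : R -> R) : measurable_fun `[0 : R, 1] u -> measurable_fun `[0 : R, 1] v ->
    (forall t, t \in `[0, 1] -> ~ S t -> u t = v t) ->
    (\int[mu]_(t in `[0, 1]) u t)%R = (\int[mu]_(t in `[0, 1]) v t)%R.
  move=> mu_ mv uv; congr fine; apply: ae_eq_integral => //.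
  - exact/measurable_EFinP.
  - exact/measurable_EFinP.
  exists S; split=> // t /= H; apply: contrapT => nS; apply: H => t01.
  by rewrite uv.
congr (_ +i* _); apply: aeS => // t t01 nS.
  by rewrite hk.
by rewrite hk.
Qed.

End ComplexIntegral.

(** * Winding numbers *)

Section Winding.
Context {R : realType} (g : R -> R[i]).
Hypothesis hg : simple_contour g.
Implicit Types (w z : R[i]).
Local Notation mu := (@lebesgue_measure R).
Local Notation Re := (@complex.Re R).
Local Notation Im := (@complex.Im R).

Lemma contour_pieces : exists ts : seq R, [/\ path <%R 0 ts, last 0 ts = 1 &
  forall k, (k < size ts)%N -> exists h1 h2 : R -> R,
    [/\ C1_with (0 :: ts)`_k ts`_k (Re \o g) h1,
        C1_with (0 :: ts)`_k ts`_k (Im \o g) h2 &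
        {in `](0 :: ts)`_k, ts`_k[, forall t, velocity g t = h1 t +i* h2 t}]].
Proof.
have [[ts /andP[pts /eqP lts] hk] _ _] := hg; exists ts; split=> // k kts.
have [/C1_on_with[h1 [c1 e1]] /C1_on_with[h2 [c2 e2]]] := hk k kts.
by exists h1, h2; split=> // t tk; rewrite /velocity e1// e2.
Qed.

Lemma admissible_contour : admissible g.
Proof.
have [ts [pts lts hk]] := contour_pieces.
apply: bounded_measurable_admissible; rewrite -lts;
  apply: bounded_measurable_path => // k /hk[h1 [h2 [[? ? ?] [? ? ?] _]]].
  by exists (Re \o g).
by exists (Im \o g).
Qed.

Lemma admissible_velocity : admissible (velocity g).
Proof.
have [ts [pts lts hk]] := contour_pieces.
apply: bounded_measurable_admissible; rewrite -lts;
  apply: bounded_measurable_path => // k /hk[h1 [h2 [[? ? ?] [? ? ?] v]]].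
  by exists h1 => // t tk; rewrite -[LHS]/(Re (velocity g t)) v.
by exists h2 => // t tk; rewrite -[LHS]/(Im (velocity g t)) v.
Qed.

(** On each piece the squared distance to [w] is continuous and attains a positive minimum; finitely
    many pieces are glued by taking minima. *)
Lemma contour_trace_dist w : ~ contour_trace g w ->
  exists2 d : R, 0 < d & forall t, t \in `[0, 1] -> d <= normc (g t - w).
Proof.
move=> wg; have [ts [pts lts hk]] := contour_pieces.
pose Q s t := 0 <= s -> t <= 1 ->
  exists2 d : R, 0 < d & forall x, x \in `[s, t] -> d <= normc (g x - w).
have gw x : 0 <= x -> x <= 1 -> 0 < normc (g x - w).
  move=> x0 x1; rewrite lt_neqAle normc_ge0 andbT eq_sym; apply/eqP => /eq0_normc.
  by move=> /subr0_eq E; apply: wg; exists x => //=; rewrite in_itv /= x0.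
have [] : Q 0 (last 0 ts) /\ 0 <= last 0 ts; last first.
  by rewrite lts => /(_ (lexx _) (lexx _)).
apply: piece_induction pts.
- move=> a a0 a1; exists (normc (g a - w)); first exact: gw.
  by move=> x; rewrite in_itv /= => /andP[ax xa]; rewrite (_ : x = a)//; lra.
- move=> a b c ab bc Qab Qbc a0 c1.
  have [d1 d10 h1] := Qab a0 (le_trans bc c1).
  have [d2 d20 h2] := Qbc (le_trans a0 (ltW ab)) c1.
  exists (Num.min d1 d2); first by rewrite lt_min d10.
  move=> x; rewrite in_itv /= => /andP[ax xc]; rewrite ge_min.
  have [xb|bx] := leP x b; first by rewrite h1// in_itv /= ax.
  by rewrite h2 ?orbT// in_itv /= (ltW bx).
move=> k /hk[h1 [h2 [[c1 _ _] [c2 _ _] _]]].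
move: ((0 :: ts)`_k) (ts`_k) c1 c2 => s t c1 c2 s0 t1.
have [st|ts_] := leP s t; last first.
  exists 1 => // x; rewrite in_itv /= => /andP[sx xt].
  by have := le_trans sx xt; rewrite leNgt ts_.
pose N x := (Re (g x) - Re w) * (Re (g x) - Re w) +
            (Im (g x) - Im w) * (Im (g x) - Im w).
have nN x : normc (g x - w) = Num.sqrt (N x).
  by rewrite /N -!expr2; case: (g x) => ? ?; case: (w).
have cN : {within `[s, t], continuous N}.
  have cu : {within `[s, t], continuous (fun x => Re (g x) - Re w)}.
    by move=> x; apply: cvgB; [exact: c1|exact: cvg_cst].
  have cv : {within `[s, t], continuous (fun x => Im (g x) - Im w)}.
    by move=> x; apply: cvgB; [exact: c2|exact: cvg_cst].
  have cuu := within_continuousM cu cu; have cvv := within_continuousM cv cv.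
  by move=> x; apply: cvgD; [exact: cuu|exact: cvv].
have [c] := EVT_min st cN; rewrite in_itv /= => /andP[sc ct] cmin.
exists (normc (g c - w)); first by apply: gw; lra.
by move=> x xst; rewrite !nN ler_wsqrtr// cmin.
Qed.

Lemma admissible_inv w : ~ contour_trace g w -> admissible (fun t => (g t - w)^-1).
Proof.
move=> /contour_trace_dist[d d0 hd]; apply: admissibleV hd _ => //.
exact: admissibleD admissible_contour (admissible_cst _).
Qed.

(** Along the closed curve the integrand has primitive [- (z - w)^-1]. Its real and imaginary parts,
    [- u / N] and [v / N] with [g t - w = u + i v] and [N = u^2 + v^2], are handled by
    [FTC_path]. *)
Lemma contour_integral_inv_sqr w : ~ contour_trace g w ->
  contour_integral g (fun z => (z - w)^-1 * (z - w)^-1) = 0.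
Proof.
move=> wg; have [ts [pts lts hk]] := contour_pieces.
have [d d0 hd] := contour_trace_dist wg.
set H := fun t => (g t - w)^-1 * (g t - w)^-1 * velocity g t.
have aH : admissible H.
  apply: admissibleM admissible_velocity; apply: admissibleM; exact: admissible_inv.
have [bR bI] := admissible_bounded_measurable aH.
pose N x := (Re (g x) - Re w) * (Re (g x) - Re w) +
            (Im (g x) - Im w) * (Im (g x) - Im w).
have g01 : g 1 = g 0 by have [_ ->] := hg.
have N0 x : x \in `[0, 1] -> N x != 0.
  move=> x01; have := lt_le_trans d0 (hd x x01).
  have -> : normc (g x - w) = Num.sqrt (N x).
    by rewrite /N -!expr2; case: (g x) => ? ?; case: (w).
  by rewrite sqrtr_gt0 => /lt0r_neq0.
have sub k : (k < size ts)%N -> {subset `[(0 :: ts)`_k, ts`_k] <= `[0, 1]}.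
  move=> kts x; have := path_subitv pts kts; rewrite lts !in_itv /=.
  by move=> [a0 b1] /andP[ax xb]; rewrite (le_trans a0)//= (le_trans xb).
rewrite -[LHS]/(_ +i* _); congr (_ +i* _).
  rewrite -lts (@FTC_path _ _ _ (fun t => - ((Re (g t) - Re w) * (N t)^-1)))//.
  - by rewrite lts /N g01 subrr.
  - by rewrite lts.
  move=> k kts; have [h1 [h2 [c1 c2 v]]] := hk k kts.
  have cu := C1_withB (Re w) c1; have cv := C1_withB (Im w) c2.
  have cN := C1_withD (C1_withM cu cu) (C1_withM cv cv).
  have cNV := C1_withV cN (fun x xk => N0 x (sub k kts x xk)).
  have := C1_withN (C1_withM cu cNV); set f := (X in C1_with _ _ _ X) => cf.
  exists f => // t tk; rewrite /H /= v// /f /=.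
  have := N0 t (sub k kts t (subset_itv_oo_cc tk)); rewrite /N.
  case: (g t) => a b; case: (w) => a' b' /= nz.
  by rewrite -?expr2; field.
rewrite -lts (@FTC_path _ _ _ (fun t => (Im (g t) - Im w) * (N t)^-1))//.
- by rewrite lts /N g01 subrr.
- by rewrite lts.
move=> k kts; have [h1 [h2 [c1 c2 v]]] := hk k kts.
have cu := C1_withB (Re w) c1; have cv := C1_withB (Im w) c2.
have cN := C1_withD (C1_withM cu cu) (C1_withM cv cv).
have cNV := C1_withV cN (fun x xk => N0 x (sub k kts x xk)).
have := (C1_withM cv cNV); set f := (X in C1_with _ _ _ X) => cf.
exists f => // t tk; rewrite /H /= v// /f /=.
have := N0 t (sub k kts t (subset_itv_oo_cc tk)); rewrite /N.
case: (g t) => a b; case: (w) => a' b' /= nz.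
by rewrite -?expr2; field.
Qed.

End Winding.

(** * Local constancy of the Cauchy integral *)

Section WindingConstant.
Context {R : realType} (g : R -> R[i]).
Hypothesis hg : simple_contour g.
Implicit Types (w z : R[i]).
Local Notation Re := (@complex.Re R).
Local Notation Im := (@complex.Im R).

Definition cauchy_integral w : R[i] := contour_integral g (fun z => (z - w)^-1).

Lemma far_not_trace w (d : R) : 0 < d ->
  (forall t, t \in `[0, 1] -> d <= normc (g t - w)) -> ~ contour_trace g w.
Proof.
move=> d0 hd [t t01 E]; have := hd t t01.
by rewrite E subrr normc0 leNgt d0.
Qed.

Lemma velocity_bound : exists2 V : R, 0 <= V &
  forall t, t \in `[0, 1] -> normc (velocity g t) <= V.
Proof.
have [_ [V hV]] := admissible_velocity hg; exists `|V| => // t t01.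
by rewrite (le_trans (hV t t01))// ler_norm.
Qed.

(** Subtracting [(w - w') / (z - w)^2], whose integral is 0, from the difference of the two Cauchy
    kernels leaves a multiple of [(w - w')^2]. *)
Lemma cauchy_integral_quadratic w0 (d : R) : 0 < d ->
  (forall t, t \in `[0, 1] -> d *+ 2 <= normc (g t - w0)) ->
  exists2 C : R, 0 <= C & forall w w', normc (w - w0) <= d -> normc (w' - w0) <= d ->
    normc (cauchy_integral w - cauchy_integral w') <= C * normc (w - w') ^+ 2.
Proof.
move=> d0 hd; have [V V0 hV] := velocity_bound.
(* Three inverse factors are at most [d^-1] each, the velocity is at most [V], and 2 comes from
   [normc_integral01]. *)
exists (2 * (d^-1 ^+ 3 * V)); first by rewrite mulr_ge0// mulr_ge0// exprn_ge0// invr_ge0 ltW.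
move=> w w' hw hw'.
have far z : normc (z - w0) <= d -> forall t, t \in `[0, 1] -> d <= normc (g t - z).
  move=> hz t t01; have := hd t t01.
  have := normc_triangle (g t - z) (z - w0); rewrite subrKA.
  by move: hz; rewrite mulr2n; lra.
have [fw fw'] := (far w hw, far w' hw').
have [nw nw'] := (far_not_trace d0 fw, far_not_trace d0 fw').
have [aw aw'] := (admissible_inv hg nw, admissible_inv hg nw').
have av := admissible_velocity hg.
have ai := admissibleM aw av; have ai' := admissibleM aw' av.
have aii := admissibleM (admissibleM aw aw) av.
have a1 := admissibleM (admissible_cst (-1)) ai'.
have a2 := admissibleM (admissible_cst (- (w - w'))) aii.
have -> : cauchy_integral w - cauchy_integral w' = integral01 (fun t =>
    ((g t - w)^-1 * velocity g t + -1 * ((g t - w')^-1 * velocity g t)) +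
    - (w - w') * ((g t - w)^-1 * (g t - w)^-1 * velocity g t)).
  rewrite integral01D//; last exact: admissibleD.
  rewrite integral01D// !integral01Z//.
  have := contour_integral_inv_sqr hg nw; rewrite /contour_integral => ->.
  by rewrite mulr0 addr0 mulN1r.
rewrite -mulrA; apply: normc_integral01; first exact: (admissibleD (admissibleD ai a1) a2).
move=> t t01.
have neq0 z : d <= normc (g t - z) -> g t - z != 0.
  by move=> h; apply/eqP => E; move: h; rewrite E normc0 leNgt d0.
have n0 := neq0 w (fw t t01); have n0' := neq0 w' (fw' t t01).
have -> : ((g t - w)^-1 * velocity g t + -1 * ((g t - w')^-1 * velocity g t)) +
    - (w - w') * ((g t - w)^-1 * (g t - w)^-1 * velocity g t) =
    - ((w - w') * (w - w')) *
    ((g t - w)^-1 * (g t - w)^-1 * (g t - w')^-1 * velocity g t).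
  by field; rewrite n0 n0'.
rewrite normcM normcN !normcM -expr2 mulrC ler_wpM2r ?sqr_ge0//.
have inv_le z : d <= normc (g t - z) -> normc (g t - z)^-1 <= d^-1.
  by move=> h; rewrite normcV lef_pV2 ?posrE// (lt_le_trans d0).
have dV : 0 <= d^-1 by rewrite invr_ge0 ltW.
rewrite ler_pM ?mulr_ge0 ?normc_ge0 ?hV//.
rewrite !exprS expr0 mulr1 mulrA.
by rewrite !ler_pM ?mulr_ge0 ?normc_ge0 ?inv_le ?fw ?fw'.
Qed.

(** Along a segment cut into [n + 1] equal steps, the quadratic bound gives a total variation of at
    most [C d^2 / (n + 1)], which is arbitrarily small. *)
Lemma cauchy_integral_ball w0 (d : R) w : 0 < d ->
  (forall t, t \in `[0, 1] -> d *+ 2 <= normc (g t - w0)) ->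
  normc (w - w0) <= d -> cauchy_integral w = cauchy_integral w0.
Proof.
move=> d0 hd hw; have [C C0 hC] := cauchy_integral_quadratic d0 hd.
pose p n k := w0 + (k%:R / n.+1%:R)%:C * (w - w0).
have np n k : (k <= n.+1)%N -> normc (p n k - w0) <= d.
  move=> kn; rewrite /p addrC addKr normcM.
  have -> : normc (k%:R / n.+1%:R)%:C = k%:R / n.+1%:R :> R.
    by rewrite /= expr0n /= addr0 sqrtr_sqr ger0_norm// divr_ge0.
  rewrite (le_trans _ hw)// ler_piMl ?normc_ge0//.
  by rewrite ler_pdivrMr ?ltr0n// mul1r ler_nat.
have step n k : (k < n.+1)%N ->
    normc (cauchy_integral (p n k.+1) - cauchy_integral (p n k)) <=
    C * (d / n.+1%:R) ^+ 2.
  move=> kn; apply: (le_trans (hC _ _ (np _ _ kn) (np _ _ (ltnW kn)))).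
  rewrite ler_wpM2l// ler_sqr ?nnegrE ?normc_ge0 ?divr_ge0 ?(ltW d0)//.
  have -> : p n k.+1 - p n k = (n.+1%:R^-1)%:C * (w - w0).
    rewrite /p opprD addrACA subrr add0r -mulrBl -rmorphB -mulrBl.
    by rewrite -natrB// subSnn mul1r.
  rewrite normcM (_ : normc _%:C = n.+1%:R^-1 :> R); last first.
    by rewrite /= expr0n /= addr0 sqrtr_sqr ger0_norm// invr_ge0.
  by rewrite mulrC ler_wpM2r// invr_ge0.
have tele n k : (k <= n.+1)%N ->
    normc (cauchy_integral (p n k) - cauchy_integral w0) <=
    k%:R * (C * (d / n.+1%:R) ^+ 2).
  elim: k => [_|k IHk kn].
    by rewrite /p mul0r mul0r addr0 subrr normc0 mul0r.
  rewrite -(subrKA (cauchy_integral (p n k))).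
  rewrite (le_trans (normc_triangle _ _))// -natr1 mulrDl mul1r [leRHS]addrC.
  have h1 := step n k kn; have h2 := IHk (ltnW kn).
  exact: lerD h1 h2.
apply/subr0_eq/normc_lt0_eq => e e0.
pose n := Num.truncn (C * d ^+ 2 / e).
have := tele n n.+1 (leqnn _).
rewrite {1}/p divff ?pnatr_eq0// mul1r subrKC => /le_trans; apply.
have nC : C * d ^+ 2 / e <= n.+1%:R by rewrite ltW// truncnS_gt.
have n0 : n.+1%:R != 0 :> R by rewrite pnatr_eq0.
have -> : n.+1%:R * (C * (d / n.+1%:R) ^+ 2) = C * d ^+ 2 / n.+1%:R.
  by move: n.+1%:R n0 => a a0; field.
by rewrite ler_pdivrMr ?ltr0n// [e * _]mulrC -ler_pdivrMr.
Qed.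

End WindingConstant.

(** * The Cauchy integral on components of the complement *)

Section WindingOutside.
Context {R : realType} (g : R -> R[i]).
Hypothesis hg : simple_contour g.
Implicit Types (w z : R[i]).

Definition cauchy_level (P : R[i] -> Prop) : set (R[i] : numFieldType) :=
  [set w | ~ contour_trace g w /\ P (cauchy_integral g w)].

Lemma open_cauchy_level (P : R[i] -> Prop) : open (cauchy_level P).
Proof.
rewrite openE => w [wg Pw]; have [d d0 hd] := contour_trace_dist hg wg.
(* Half the distance to the trace: the ball avoids the contour, and [cauchy_integral_ball] applies
   since twice the radius is [d]. *)
apply/nbhs_ballP; exists (d / 2)%:C => /=; first by rewrite ltcR divr_gt0.
move=> y; rewrite -ball_normE /= => wy.
have {}wy : normc (y - w) < d / 2 by rewrite normc_distC -ltcR.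
split.
  move=> [t t01 E]; have := hd t t01; rewrite E => dy.
  by lra.
rewrite (@cauchy_integral_ball _ _ hg w (d / 2))//; first by lra.
  by move=> t t01; have := hd t t01; rewrite mulr2n; lra.
exact: ltW.
Qed.

(** By local constancy, the set where the value at [w0] is taken is open and closed in the connected
    component. *)
Lemma cauchy_integral_component w0 w : ~ contour_trace g w0 ->
  component_of g w0 w -> cauchy_integral g w = cauchy_integral g w0.
Proof.
move=> w0g cw; set A := component_of g w0.
have cA : connected A by exact: component_connected.
have sA z : A z -> ~ contour_trace g z by move=> /connected_component_sub.
pose B : set (R[i] : numFieldType) :=
  A `&` [set z | cauchy_integral g z = cauchy_integral g w0].
suff BA : B = A by have : A w by []; rewrite -BA => -[].
apply: cA.
- by exists w0; split=> //; exact: connected_component_refl.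
- exists (cauchy_level (fun v => v = cauchy_integral g w0)).
    exact: open_cauchy_level.
  by apply/seteqP; split=> z [Az]; [move=> E; split=> //; split=> //; exact: sA|
    move=> [_ E]].
exists (~` cauchy_level (fun v => v <> cauchy_integral g w0)).
  by apply: open_closedC; exact: open_cauchy_level.
apply/seteqP; split=> z [Az]; first by move=> E; split=> // -[_ ]; apply.
by move=> H; split=> //; apply: contrapT => ne; apply: H; split=> //; exact: sA.
Qed.

Lemma unbounded_normc (A : set (R[i] : numFieldType)) : ~ bounded_set A ->
  forall M : R, exists2 z, A z & M < normc z.
Proof.
move=> ub M; apply: contrapT => H; apply: ub.
exists M%:C; split; first by rewrite complex_real.
move=> x Mx z Az /=; apply: ltW; apply: le_lt_trans Mx.
rewrite -[ `|z| ]/((normc z)%:C) lecR leNgt; apply/negP => Mz.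
by apply: H; exists z.
Qed.

(** The integral is constant on the component, which contains points arbitrarily far from the
    contour, where it is arbitrarily small. *)
Lemma cauchy_integral_outside w : lies_outside g w -> cauchy_integral g w = 0.
Proof.
move=> [wg ub]; apply: normc_lt0_eq => e e0.
have [V V0 hV] := velocity_bound hg; have [_ [G hG]] := admissible_contour hg.
(* At distance [D] the integral is at most [2 V / D <= e]; the summand 1 keeps [D] positive. *)
pose D := (2 * V) / e + 1.
have D0 : 0 < D by rewrite ltr_wpDl// divr_ge0 ?mulr_ge0 ?(ltW e0).
have [z Az hz] := unbounded_normc ub (G + D).
rewrite -(cauchy_integral_component wg Az).
have far t : t \in `[0, 1] -> D <= normc (g t - z).
  move=> t01; have := hG t t01; have := normc_triangle (z - g t) (g t).
  by rewrite subrK (normc_distC z); lra.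
have ai := admissibleM (admissible_inv hg (far_not_trace D0 far))
                       (admissible_velocity hg).
apply: (@le_trans _ _ (2 * (D^-1 * V))).
  apply: normc_integral01 ai _ => t t01.
  rewrite normcM ler_pM ?normc_ge0 ?hV// normcV lef_pV2 ?posrE ?far//.
  exact: lt_le_trans D0 (far t t01).
rewrite [D^-1 * V]mulrC mulrA ler_pdivrMr// /D mulrDr mulr1 mulrCA divff ?gt_eqF//.
by rewrite mulr1 lerDl ltW.
Qed.

Lemma cauchy_integral_encircled w : positively_oriented g -> encircles g w ->
  cauchy_integral g w = two_pi_i.
Proof.
move=> pg /pg; rewrite /winding_number -/(cauchy_integral g w).
move=> /(congr1 (fun v => two_pi_i * v)).
rewrite mulr1 mulVKf//.
by apply/eqP => -[/eqP]; rewrite mulf_eq0 pnatr_eq0 /= gt_eqF ?pi_gt0.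
Qed.

End WindingOutside.

(** * Evaluation by residues at the poles *)

Section Residues.
Context {R : realType} (g : R -> R[i]) (N : nat) (nu : N.-tuple int) (x : int).
Hypothesis hC : is_contour_for nu x g.
Hypothesis hnu : nu \in GT N.
Implicit Type r : 'I_N.
Local Notation p := (fun r : 'I_N => (particle nu r)%:~R : R[i]).

Lemma pole_inj : injective p.
Proof.
move=> r s /intr_inj /(particle_inj hnu); rewrite !size_tuple => E.
by apply: val_inj; exact: E.
Qed.

(** By monotonicity every particle lies between the last one, [nu_N - N], and the first, [nu_1 - 1],
    so one of the two clauses of [is_contour_for] applies. *)
Lemma pole_position (r : 'I_N) : if x <= particle nu r then encircles g (p r)
  else lies_outside g (p r).
Proof.
have [sg pg inside outside] := hC.
have rN := ltn_ord r.
have le0 : particle nu r <= nu`_0 - 1.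
  have [r0|r0] := posnP r; first by rewrite /particle r0.
  have := sorted_particle hnu r0; rewrite size_tuple => /(_ rN) /ltW.
  by rewrite {2}/particle.
have geN : nu`_N.-1 - N%:Z <= particle nu r.
  have EN : nu`_N.-1 - N%:Z = particle nu N.-1.
    by rewrite /particle prednK// (leq_ltn_trans _ rN).
  have [Er|rN1] := eqVneq (r : nat) N.-1; first by rewrite EN Er.
  have := @sorted_particle nu r N.-1 hnu; rewrite size_tuple EN => H.
  by apply: ltW; apply: H; lia.
have [xp|px] := leP x (particle nu r); first by apply: inside; rewrite xp.
by apply: outside; rewrite geN /=; lia.
Qed.

Lemma pole_not_trace (r : 'I_N) : ~ contour_trace g (p r).
Proof. by have := pole_position r; case: ifP => _ []. Qed.

Lemma cauchy_integral_pole (r : 'I_N) :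
  cauchy_integral g (p r) = (x <= particle nu r)%R%:R * two_pi_i.
Proof.
have [sg pg _ _] := hC; have := pole_position r.
case: ifP => _ h; first by rewrite mul1r cauchy_integral_encircled.
by rewrite mul0r cauchy_integral_outside.
Qed.

(* Junk values [_ / 0 = 0] of the integrand on the left occur only where the
   contour meets a finite set, that is, at finitely many times. *)
Lemma contour_integral_partial_fractions (F : R[i] -> R[i]) (q : {poly R[i]})
    (S : seq R[i]) :
  (size q <= N)%N -> cmeasurable (F \o g) ->
  (forall z, (forall r : 'I_N, z != p r) -> z \notin S ->
    F z = q.[z] / \prod_(r < N) (z - p r)) ->
  contour_integral g F = two_pi_i *
    \sum_(r < N | x <= particle nu r) q.[p r] / node_weight p r.
Proof.
move=> qN mF hF; have [sg pg _ _] := hC.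
pose T := [set t : R | `[0, 1]%classic t /\ g t \in S].
have fT : finite_set T.
  (* Injectivity on [[0, 1[] lets each point of [S] be hit at most once; the time 1 is set apart. *)
  apply: (@sub_finite_set _ _ ([set 1] `|` \bigcup_(z in [set` S])
      [set t | `[0, 1[%classic t /\ g t = z])).
    move=> t [/=]; rewrite in_itv /= => /andP[t0].
    rewrite le_eqVlt => /predU1P[->|t1] tS; [by left|right].
    by exists (g t) => //; split=> //=; rewrite in_itv /= t0.
  rewrite finite_setU; split; first exact: finite_set1.
  apply: bigcup_finite; first exact: finite_seq.
  move=> z _; have [[t0 [t0I t0z]]|H] :=
    pselect (exists t0, `[0, 1[%classic t0 /\ g t0 = z).
    apply: (@sub_finite_set _ _ [set t0]); last exact: finite_set1.
    move=> t [tI tz]; have [_ _ ginj] := sg.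
    by apply: ginj => //; rewrite tz.
  apply: (@sub_finite_set _ _ set0); last exact: finite_set0.
  by move=> t Ht; apply: H; exists t.
have av := admissible_velocity sg.
have ap (r : 'I_N) : admissible (fun t => (g t - p r)^-1 * velocity g t).
  apply: admissibleM av; apply: admissible_inv => //; exact: pole_not_trace.
have apc (r : 'I_N) : admissible (fun t => (q.[p r] / node_weight p r) *
    ((g t - p r)^-1 * velocity g t)).
  by apply: admissibleM => //; exact: admissible_cst.
transitivity (integral01 (fun t => \sum_(r < N) (q.[p r] / node_weight p r) *
    ((g t - p r)^-1 * velocity g t))).
  apply: (eq_integral01_finite fT).
  - by apply: cmeasurableM => //; have [] := av.
  - by have [] := admissible_sum (index_enum 'I_N) apc.
  move=> t t01 nT; rewrite hF.
  - rewrite (partial_fractions pole_inj qN); last first.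
      move=> r; apply/eqP => E; apply: (@pole_not_trace r); rewrite -E.
      by exists t.
    by rewrite mulr_suml; apply: eq_bigr => r _; rewrite mulrA.
  - move=> r; apply/eqP => E; apply: (@pole_not_trace r); rewrite -E.
    by exists t.
  by apply/negP => tS; apply: nT; split.
rewrite integral01_sum// mulr_sumr [RHS]big_mkcond; apply: eq_bigr => r _.
rewrite integral01Z// -[integral01 _]/(cauchy_integral g (p r)).
rewrite cauchy_integral_pole.
by case: ifP => _; rewrite ?mul1r ?mul0r ?mulr0// mulrC.
Qed.

End Residues.

(** * The contour integral formula *)

Section GapPolynomial.
Variables (F : numFieldType) (K D : nat).

(** Cut the product on the right at [i] and [i + D + 1]; the middle block is the Pochhammer product
    that [gap_poly] omits. *)
Lemma horner_gap_poly (i : nat) (z : F) : (i < K)%N ->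
  (gap_poly F K D i).[z] * \prod_(k < D.+1) (z + i.+1%:R + k%:R) =
  \prod_(r < K + D) (z + r.+1%:R).
Proof.
move=> iK; rewrite -(big_mkord xpredT (fun r => z + r.+1%:R)).
rewrite (big_cat_nat (n := i)) ?leq0n//=; last by lia.
rewrite (big_cat_nat (n := (i + D.+1)%N) (m := i)) ?leq_addr//=; last by lia.
rewrite /gap_poly /rising_poly hornerM !horner_prod -mulrA; congr (_ * _).
  by rewrite big_mkord; apply: eq_bigr => s _; rewrite hornerD hornerX hornerC.
rewrite mulrC; congr (_ * _).
  rewrite -[X in _ = \prod_(X <= _ < _) _](add0n i) big_addn addKn big_mkord; apply: eq_bigr => k _.
  by rewrite addnC -addSn natrD addrA.
by apply: eq_bigr => s _; rewrite hornerD hornerX hornerC.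
Qed.

Lemma size_gap_poly i : (i < K)%N -> (size (gap_poly F K D i) <= K)%N.
Proof.
move=> iK; rewrite /gap_poly; apply: (leq_trans (size_polyMleq _ _)).
rewrite size_rising_poly (eq_bigr (fun s => 'X - (- s.+1%:R)%:P)); last first.
  by move=> s _; rewrite polyCN opprK.
by rewrite size_prod_XsubC size_iota; lia.
Qed.

End GapPolynomial.

(** Both sides equal [(m + n)! / m!]; this matches the Pochhammer factor at a pole with
    [delta_sum]. *)
Lemma prod_binomial (F : numFieldType) (m n : nat) :
  \prod_(k < n) (m%:R + 1 + k%:R) = ('C(m + n, n) * n`!)%:R :> F.
Proof.
elim: n => [|n IHn]; first by rewrite big_ord0 bin0.
rewrite big_ord_recr /= IHn; have /= bE := mul_bin_diag (m + n).+1 n.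
transitivity (((m + n).+1 * 'C(m + n, n) * n`!)%:R : F).
  by rewrite !natrM -natr1 natrD; ring.
by rewrite bE addnS factS; congr (_%:R); ring.
Qed.

Section ContourEntry.
Context {R : realType} (K D : nat) (nu : (K + D).-tuple int) (C : int -> R -> R[i]).
Hypothesis D0 : (0 < D)%N.
Hypothesis hnu : nu \in GT (K + D).
Hypothesis hC : forall x, is_contour_for nu x (C x).
Local Notation N := (K + D)%N.
Local Notation p := (fun r : 'I_N => (particle nu r)%:~R : R[i]).

(** Cancelling the denominator against the numerator of [Hstar] leaves [q] over the product of the
    [z - p r], with [size q <= N]. The residues at poles [>= x] then give the terms of the divided
    difference. *)
Lemma A_fun_divided_diff i x : (i < K)%N ->
  A_fun K nu C i.+1 x = D`!%:R * divided_diff p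
    (fun r => delta_sum R[i] D x (particle nu r) * (gap_poly R[i] K D i).[p r]).
Proof.
move=> iK; have [sg _ _ _] := hC x.
pose q0 : {poly R[i]} := \prod_(k < D.-1) ('X - (x%:~R - 1 - k%:R)%:P).
have q0E z : q0.[z] = \prod_(k < D.-1) (z - x%:~R + 1 + k%:R).
  by rewrite /q0 horner_prod; apply: eq_bigr => k _; rewrite hornerXsubC; ring.
pose q := q0 * gap_poly R[i] K D i.
have sq : (size q <= N)%N.
  apply: (leq_trans (size_polyMleq _ _)).
  have s0 : size q0 = D.
    by rewrite size_prod_XsubC /index_enum -enumT size_enum_ord prednK.
  rewrite s0; have := size_gap_poly R[i] D iK.
  by move: (size (gap_poly _ _ _ _)) => m; lia.
rewrite /A_fun addKn subn1 addn1.
(* The exceptional points [-1, ..., -N] are the zeros of the numerator of [Hstar]; there the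
   cancelled factor may vanish. *)
rewrite (@contour_integral_partial_fractions _ _ _ nu x _ _ _ q
  [seq - k.+1%:R | k <- iota 0 N])//; last 2 first.
- have mg : cmeasurable (C x) by have [] := admissible_contour sg.
  have mc := @cmeasurable_cst R.
  apply: cmeasurableM; first apply: cmeasurableM.
  + apply: cmeasurable_prod => k; do ?apply: cmeasurableD => //; exact: mc.
  + apply: cmeasurableV; apply: cmeasurable_prod => k.
    by do ?apply: cmeasurableD => //; exact: mc.
  apply: cmeasurable_prod => r; apply: cmeasurableM.
    by apply: cmeasurableD => //; exact: mc.
  by apply: cmeasurableV; do ?apply: cmeasurableD => //; exact: mc.
- move=> z zp zS.
  have z0 k : (k < N)%N -> z + k.+1%:R != 0.
    move=> kN; rewrite addr_eq0; apply: contra zS => /eqP ->.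
    by apply/mapP; exists k => //; rewrite mem_iota.
  rewrite /pochhammer /Hstar -q0E big_split /= -(horner_gap_poly D z iK) prodfV.
  have -> : \prod_(r < N) (z + r.+1%:R - (tnth nu r)%:~R) = \prod_(r < N) (z - p r).
    apply: eq_bigr => r _; rewrite /particle (tnth_nth 0) rmorphB /=; ring.
  have -> : q.[z] = q0.[z] * (gap_poly R[i] K D i).[z] by rewrite /q hornerM.
  have n0 : \prod_(k < D.+1) (z + i.+1%:R + k%:R) != 0.
    apply/prodf_neq0 => k _; rewrite -addrA -natrD addSn z0//.
    by have := ltn_ord k; lia.
  rewrite !mulrA; congr (_ / _).
  by move: q0.[z] (gap_poly _ _ _ _).[z] (\prod_(k < D.+1) _) n0 => a b c c0; field.
rewrite mulrA divfK; last first.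
  by apply/eqP => -[/eqP]; rewrite mulf_eq0 pnatr_eq0 /= gt_eqF ?pi_gt0.
rewrite /divided_diff !mulr_sumr [LHS]big_mkcond; apply: eq_bigr => r _.
(* Poles to the left of [x] are not encircled, and [delta_sum] vanishes there as well. *)
rewrite /delta_sum; case: ifP => xr; last first.
  have : particle nu r - x < 0 by lia.
  by case: (_ - x) => // m _; rewrite !mul0r mulr0.
have [m mE] : exists m : nat, particle nu r - x = m by exists `|particle nu r - x|%N; lia.
have qE : q.[p r] = q0.[p r] * (gap_poly R[i] K D i).[p r] by rewrite /q hornerM.
rewrite mE qE q0E -rmorphB mE !mulrA; congr (_ * _ / _).
(* The prefactor [D = n + 1] joins the [n!] of [prod_binomial] to form [D!]. *)
case: D D0 => // n _ /=.
by rewrite prod_binomial factS -!natrM; congr (_%:R); lia.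
Qed.

End ContourEntry.

Theorem theorem1p2 (R : realType) (K N : nat) (hK : (1 <= K)%N) (hKN : (K < N)%N)
  (kappa : K.-tuple int) (nu : N.-tuple int)
  (hkappa : kappa \in GT K) (hnu : nu \in GT N)
  (C : int -> R -> R[i]) (hC : forall x : int, is_contour_for nu x (C x)) :
  (DimKN kappa nu)%:R / (Dim nu)%:R =
    \det (\matrix_(i < K, j < K) A_fun K nu C i.+1 (tnth kappa j - j.+1%:Z)).
Proof.
have [D D0 E] : exists2 D, (0 < D)%N & N = (K + D)%N.
  by exists (N - K)%N; lia.
subst N.
rewrite /DimKN /Dim (@card_chains D)// ?size_tuple 1?addnC//.
rewrite (@card_chains (K + D))// ?size_tuple ?addn0//.
rewrite !size_enum_chains_det ?size_tuple ?addn0// 1?addnC//.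
pose p (r : 'I_(K + D)) : R[i] := (particle nu r)%:~R.
pose f (c : nat) (r : 'I_(K + D)) := delta_sum R[i] D (particle kappa c) (particle nu r).
have p_inj : injective p by exact: pole_inj.
(* In the denominator the chains start from the empty signature, so all columns are polynomial. *)
transitivity (\det (\matrix_(r < K + D, c < K + D) if (c < K)%N then f c r
        else (binom_poly R[i] ((K + D).-1 - c)).[p r]) /
  \det (\matrix_(r < K + D, c < K + D) (binom_poly R[i] ((K + D).-1 - c)).[p r])).
  congr (_ / _); congr (\det _); apply/matrixP => r c; rewrite !mxE //.
  by rewrite /count_column addKn.
rewrite (det_ratio p_inj) -det_gap_poly; congr (\det _).
apply/matrixP => i j; rewrite !mxE (A_fun_divided_diff D0 hnu hC)//.
by rewrite (tnth_nth 0).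
Qed.
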